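(* Let $n\geq 2$ and let $I_n$ be the partial inner automorphism group of the free group $F_n$ (defined in the context). For every integer $k\geq 1$, $$\mathcal{I}_n(k):=\mathcal{A}_n(k)\cap I_n=\Gamma_k(I_n),$$ where $\Gamma_k(I_n)$ is the $k$-th term of the lower central series of $I_n$.
   Context: $F_n$ is the free group on $x_1,\dots,x_n$. For a group $G$, the lower central series is $\Gamma_1(G)=G$, $\Gamma_{k+1}(G)=(\Gamma_k(G),G)$, where $(a,b)=a^{-1}b^{-1}ab$; write $\Gamma_n(k)=\Gamma_k(F_n)$. The Andreadakis filtration is $\mathcal{A}_n(k)=\{\phi\in \mathrm{Aut}(F_n)\;:\; g^{-1}\phi(g)\in\Gamma_n(k+1)\ \text{for all } g\in F_n\}$ for $k\geq1$ (so $\mathcal{A}_n(1)=IA_n$ is the group of automorphisms acting trivially on the abelianization). For $2\leq p\leq n$ and $1\leq i\leq p$, let $\nu_{pi}\in\mathrm{Aut}(F_n)$ be the automorphism with $\nu_{pi}(x_k)=x_i^{-1}x_kx_i$ for $1\leq k\leq p$ and $\nu_{pi}(x_k)=x_k$ for $p<k\leq n$ (equivalently $\nu_{pi}=\xi_{1,i}\xi_{2,i}\cdots\xi_{p,i}$ where $\xi_{l,i}$ conjugates $x_l$ by $x_i$ and fixes the other generators, $\xi_{i,i}$ being the identity). The partial inner automorphism group $I_n$ is the subgroup of $\mathrm{Aut}(F_n)$ generated by all $\nu_{pi}$, $2\leq p\leq n$, $1\leq i\leq p$. *)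

(* Defs.v *)
From mathcomp Require Import all_boot.
Unset Printing Implicit Defensive.

Section Generic.
Variables (T : Type) (mul : T -> T -> T) (one : T) (isinv : T -> T -> Prop).

Inductive gen_by (S : T -> Prop) : T -> Prop :=
| gen_one : gen_by S one
| gen_base x : S x -> gen_by S x
| gen_mul x y : gen_by S x -> gen_by S y -> gen_by S (mul x y)
| gen_inv x y : gen_by S x -> isinv x y -> gen_by S y.

Definition comm_set (A B : T -> Prop) : T -> Prop :=
  fun c => exists a b a' b', [/\ A a, B b, isinv a a', isinv b b' &
                              c = mul (mul (mul a' b') a) b].

(* lower central series: lcs G 1 = G, lcs G (k+1) = (lcs G k, G);
   the index 0 is a harmless duplicate of G *)
Fixpoint lcs (G : T -> Prop) (k : nat) : T -> Prop :=
  match k with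
  | 0 => G
  | k'.+1 => if k' is 0 then G else gen_by (comm_set (lcs G k') G)
  end.
End Generic.
Arguments gen_by {T}.
Arguments comm_set {T}.
Arguments lcs {T}.

(* a letter (i, false) is x_i, (i, true) is x_i^{-1} *)
Definition letter (n : nat) := ('I_n * bool)%type.

Definition cancels n (a b : letter n) : bool := (a.1 == b.1) && (a.2 != b.2).

Definition reduced n (w : seq (letter n)) : bool :=
  sorted (fun a b => ~~ cancels n a b) w.

Definition cancel_cons n (a : letter n) (w : seq (letter n)) : seq (letter n) :=
  match w with
  | b :: w' => if cancels n a b then w' else a :: w
  | [::] => [:: a]
  end.

Definition reduce n (w : seq (letter n)) := foldr (cancel_cons n) [::] w.

Lemma cancel_cons_reduced n (a : letter n) w :
  reduced n w -> reduced n (cancel_cons n a w).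
Proof.
case: w => [|b w] //= H.
case: ifP => Hab /=; first exact: path_sorted H.
by rewrite /reduced /= Hab H.
Qed.

Lemma reduce_reduced n (w : seq (letter n)) : reduced n (reduce n w).
Proof. by elim: w => [|a w IH] //=; apply: cancel_cons_reduced. Qed.

Definition FG (n : nat) := {w : seq (letter n) | reduced n w}.

Definition FG_of n (w : seq (letter n)) : FG n := exist _ (reduce n w) (reduce_reduced n w).

Definition FGmul n (u v : FG n) : FG n := FG_of n (val u ++ val v).
Definition FGone n : FG n := exist _ [::] (erefl true).
Definition FGinv n (u : FG n) : FG n :=
  FG_of n (rev (map (fun a : letter n => (a.1, ~~ a.2)) (val u))).
Definition FGgen n (i : 'I_n) : FG n := FG_of n [:: (i, false)].
Definition FGisinv n (u v : FG n) : Prop := v = FGinv n u.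

Definition GammaF (n k : nat) : FG n -> Prop :=
  lcs (FGmul n) (FGone n) (FGisinv n) (fun _ => True) k.

(* an endomorphism is determined by the images of the generators *)
Definition End_ (n : nat) := {ffun 'I_n -> FG n}.

Definition img n (f : End_ n) (a : letter n) : FG n :=
  if a.2 then FGinv n (f a.1) else f a.1.

Definition evalE n (f : End_ n) (g : FG n) : FG n :=
  foldr (fun a acc => FGmul n (img n f a) acc) (FGone n) (val g).

Definition isAut n (f : End_ n) : Prop := bijective (evalE n f).

Definition compE n (f g : End_ n) : End_ n := [ffun i => evalE n f (g i)].
Definition idE n : End_ n := [ffun i => FGgen n i].
Definition isinvE n (f g : End_ n) : Prop := compE n f g = idE n /\ compE n g f = idE n.

Definition GammaAut n (G : End_ n -> Prop) (k : nat) : End_ n -> Prop :=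
  lcs (compE n) (idE n) (isinvE n) G k.

Definition Andreadakis (n k : nat) (phi : End_ n) : Prop :=
  isAut n phi /\ forall g : FG n, GammaF n k.+1 (FGmul n (FGinv n g) (evalE n phi g)).

(* nu_{p i}, with 0-based indices: conjugates x_k by x_i for k < p *)
Definition nu n (p : nat) (i : 'I_n) : End_ n :=
  [ffun k : 'I_n => if (k < p)%N
                    then FGmul n (FGinv n (FGgen n i)) (FGmul n (FGgen n k) (FGgen n i))
                    else FGgen n k].

(* generators nu_{p i}, 2 <= p <= n, 1 <= i <= p (1-based) *)
Definition nu_gens n (f : End_ n) : Prop :=
  exists (p : nat) (i : 'I_n), [/\ (2 <= p)%N, (p <= n)%N, (i < p)%N & f = nu n p i].

Definition PartialInner n : End_ n -> Prop :=
  gen_by (compE n) (idE n) (isinvE n) (nu_gens n).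

(* Main.v *)
From HB Require Import structures.
From mathcomp Require Import all_boot all_algebra.
From mathcomp Require Import boolp functions.
From mathcomp Require Import zify.
Require Import Defs.

Set Implicit Arguments.
Unset Strict Implicit.
Unset Printing Implicit Defensive.

(* The key input is Magnus' theorem: [g] lies in the [k.+1]-st term of the lower
   central series of the free group as soon as its Magnus expansion is [1] up to
   degree [k].  It is proved by Lazard elimination.  A system of commutators whose
   Magnus expansions have leading words forming a code generates the free group
   modulo the [k.+1]-st term; splitting off the element [x] whose leading word
   [l] is smallest replaces every other [y] by the [[y, x, .., x]], whose leading
   words [l .. l v] again form a code.  Once the words of length at most [k] are
   exhausted, every [g] is either in the [k.+1]-st term or has a leading word of
   length at most [k].

   An element of [I_n] is a product [c_n(w_n) .. c_2(w_2)], with [w_p] in the free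
   group on [x_1 .. x_p] and [c_p(w)] the conjugation of these generators by [w].
   If it lies in [A_n(k)], its value at [x_n] shows that [w_n] commutes with [x_n]
   modulo the [k.+1]-st term, so [w_n] is a power of [x_n] modulo the [k]-th one;
   its value at [x_1] shows that the exponent is [0] when [k >= 2].  Hence
   [c_n(w_n)] is in the [k]-th term of [I_n], and one continues with the remaining
   factors.  The converse inclusion holds because the [A_n(k)] form a central
   filtration. *)

Import GRing.Theory.
Local Open Scope group_scope.

(** * Lower central series of an arbitrary group *)

Section LowerCentralSeries.
Variable G : groupType.
Implicit Types (x y z : G) (S H : G -> Prop).

Definition is_subgroup H :=
  [/\ H 1, forall x y, H x -> H y -> H (x * y) & forall x, H x -> H x^-1].

Definition generated S : G -> Prop := gen_by *%g 1 (fun x y => y = x^-1) S.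

(** For the group structure put on [FG n] below, this is convertible to [GammaF n k]. *)
Definition gamma (k : nat) : G -> Prop :=
  lcs *%g 1 (fun x y => y = x^-1) (fun _ => True) k.

Lemma generated_subgroup S : is_subgroup (generated S).
Proof.
split; first exact: gen_one.
  by move=> x y; apply: gen_mul.
by move=> x Hx; apply: gen_inv Hx _.
Qed.

Lemma generated_min S H :
  is_subgroup H -> (forall x, S x -> H x) -> forall x, generated S x -> H x.
Proof.
case=> H1 HM HV SH x; elim=> {x} [|x /SH|x y _ Hx _ Hy|x y _ Hx ->] //.
  exact: HM.
exact: HV.
Qed.

Lemma gammaSS k x :
  gamma k.+2 x =
  generated (comm_set *%g (fun x y => y = x^-1) (gamma k.+1) (fun _ => True)) x.
Proof. by []. Qed.

Lemma gamma_subgroup k : is_subgroup (gamma k).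
Proof. by case: k => [|[|k]] //; apply: generated_subgroup. Qed.

Lemma gamma1 k : gamma k 1.
Proof. by case: (gamma_subgroup k). Qed.

Lemma gammaM k x y : gamma k x -> gamma k y -> gamma k (x * y).
Proof. by case: (gamma_subgroup k) => _ + _; apply. Qed.

Lemma gammaV k x : gamma k x -> gamma k x^-1.
Proof. by case: (gamma_subgroup k) => _ _; apply. Qed.

Definition gsimp :=
  (@invgM G, @invgK G, @mulgA G, @mulgK G, @mulgVK G, @mulgV G, @mulVg G,
   @mul1g G, @mulg1 G, @invg1 G).

Lemma gamma_comm1 k x y : gamma k.+1 x -> gamma k.+2 [~ x, y].
Proof.
move=> Hx; apply: gen_base; exists x, y, x^-1, y^-1.
by split; rewrite // /commg /conjg !gsimp.
Qed.

Lemma gamma_conj k x y : gamma k x -> gamma k (x ^ y).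
Proof.
elim: k x y => [|[|k] IH] // x y; rewrite gammaSS; move: x.
apply: generated_min; first split.
- by rewrite conj1g; apply: gamma1.
- by move=> x z Hx Hz; rewrite conjMg; apply: gammaM.
- by move=> x Hx; rewrite conjVg; apply: gammaV.
move=> _ [a [b [_ [_ [Ha _ -> -> ->]]]]].
have -> : a^-1 * b^-1 * a * b = [~ a, b] by rewrite /commg /conjg !gsimp.
by rewrite conjRg; apply/gamma_comm1/IH.
Qed.

Lemma gamma_le k l x : k <= l -> gamma l x -> gamma k x.
Proof.
move/subnK <-; elim: (l - k) => // {l} m IH Hx; apply: IH.
move: Hx; rewrite addSn; case: (m + k) => [|l] //; rewrite gammaSS.
apply: generated_min; first exact: gamma_subgroup.
move=> _ [a [b [_ [_ [Ha _ -> -> ->]]]]].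
(* A generating commutator is [a^-1] times a conjugate of [a], so normality suffices. *)
rewrite -!mulgA; apply: gammaM; first exact: gammaV.
by rewrite -[_ * (_ * _)]/(a ^ b); apply: gamma_conj.
Qed.

Lemma commgMr x y z : [~ x, y * z] = [~ x, z] * [~ x, y] ^ z.
Proof. by rewrite /commg /conjg !gsimp. Qed.

Lemma commgVr x y : [~ x, y^-1] = ([~ x, y] ^ y^-1)^-1.
Proof. by rewrite /commg /conjg !gsimp. Qed.

Lemma conjgV_commg x y : x ^ y^-1 = x * ([~ x, y] ^ y^-1)^-1.
Proof. by rewrite /commg /conjg !gsimp. Qed.

Lemma invgM_conj x y : (x * y)^-1 = x^-1 * (y^-1) ^ x^-1.
Proof. by rewrite /conjg !gsimp. Qed.

Lemma Hall_Witt x y z :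
  [~ x, y^-1, z] ^ y * [~ y, z^-1, x] ^ z * [~ z, x^-1, y] ^ x = 1.
Proof. by rewrite /commg /conjg !gsimp. Qed.

(** Three subgroups argument. The induction on [j] keeps [i] free because, for [y = [~ a, b]], the
    Hall-Witt identity produces one commutator in which [i] has grown by one. *)
Lemma gamma_comm i j x y :
  gamma i.+1 x -> gamma j.+1 y -> gamma (i + j).+2 [~ x, y].
Proof.
elim: j i x y => [|j IH] i x y Hx.
  by rewrite addn0 => _; apply: gamma_comm1.
rewrite gammaSS => Hy; move: y Hy i x Hx; apply: generated_min; first split.
- by move=> i x _; rewrite commg1; apply: gamma1.
- move=> y z Hy Hz i x Hx; rewrite commgMr; apply: gammaM; first exact: Hz.
  exact/gamma_conj/Hy.
- move=> y Hy i x Hx; rewrite commgVr; exact/gammaV/gamma_conj/Hy.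
move=> _ [a [b [_ [_ [Ha _ -> -> ->]]]]] i x Hx.
have -> : a^-1 * b^-1 * a * b = [~ a, b] by rewrite /commg /conjg !gsimp.
rewrite -invgR; apply: gammaV.
(* With these arguments the first factor of the identity is a conjugate of [[~ a, b, x]]. *)
have /eqP := Hall_Witt a b^-1 x; rewrite invgK -mulgA mulg_eq1 => /eqP E.
rewrite -[[~ a, b, x]](conjgK b^-1) E invgM.
apply: gamma_conj; apply: gammaM; apply: gammaV; apply: gamma_conj.
- rewrite addnS; apply: gamma_comm1; apply: IH => //; exact: gammaV.
rewrite addnS -addSn; apply: IH => //.
by rewrite -invgR; apply/gammaV/gamma_comm1/gammaV.
Qed.

End LowerCentralSeries.

(** * The free group and its endomorphisms *)

Section FreeGroup.
Variable n : nat.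
Implicit Types (a b : letter n) (u v w : seq (letter n)) (x y z : FG n).

Definition flip a : letter n := (a.1, ~~ a.2).

Lemma flipK : involutive flip.
Proof. by case=> i b; rewrite /flip /= negbK. Qed.

Lemma cancelsE a b : cancels n a b = (b == flip a).
Proof.
case: a b => [i c] [j d]; rewrite /cancels /flip xpair_eqE /= eq_sym.
by case: c d => [] [].
Qed.

(** Van der Waerden's trick: letters act invertibly on reduced words. Compatibility of [reduce] with
    concatenation, hence associativity, follows without a confluence argument. *)
Lemma cancel_consK a w :
  reduced n w -> cancel_cons n a (cancel_cons n (flip a) w) = w.
Proof.
case: w => [|b w] /=; first by rewrite cancelsE eqxx.
rewrite cancelsE flipK; case: eqP => [->|_ _] /=; last by rewrite cancelsE eqxx.
by case: w => [|c w] //= /andP[/negbTE->].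
Qed.

Lemma act_reduced u w : reduced n w -> reduced n (foldr (cancel_cons n) w u).
Proof. by move=> Hw; elim: u => [|a u IH] //=; apply: cancel_cons_reduced. Qed.

Lemma act_reduce u w :
  reduced n w -> foldr (cancel_cons n) w (reduce n u) = foldr (cancel_cons n) w u.
Proof.
move=> Hw; elim: u => [|a u IH] //=; rewrite -IH.
case: (reduce n u) => [|b v] //=; rewrite cancelsE; case: eqP => //= ->.
by rewrite cancel_consK //; apply: act_reduced.
Qed.

Lemma reduce_id w : reduced n w -> reduce n w = w.
Proof.
elim: w => [|a w IH] // Hw; rewrite /= IH; last exact: path_sorted Hw.
by case: w Hw {IH} => [|b w] //= /andP[/negbTE->].
Qed.

Lemma reduce_catr u v : reduce n (u ++ reduce n v) = reduce n (u ++ v).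
Proof. by rewrite /reduce !foldr_cat -!/(reduce n _) reduce_id // reduce_reduced. Qed.

Lemma reduce_catl u v : reduce n (reduce n u ++ v) = reduce n (u ++ v).
Proof. by rewrite /reduce !foldr_cat act_reduce // reduce_reduced. Qed.

Lemma FG_of_cat u v : FG_of n (u ++ v) = FGmul n (FG_of n u) (FG_of n v).
Proof. by apply: val_inj; rewrite /= reduce_catl reduce_catr. Qed.

Lemma FG_of_val x : FG_of n (val x) = x.
Proof. by apply: val_inj; rewrite /= reduce_id //; apply: valP. Qed.

Lemma FGmulA : associative (FGmul n).
Proof.
move=> x y z; apply: val_inj.
by rewrite /= reduce_catl reduce_catr catA.
Qed.

Lemma FGmul1 : left_id (FGone n) (FGmul n).
Proof. by move=> x; rewrite /FGmul /= FG_of_val. Qed.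

Lemma FGmulr1 : right_id (FGone n) (FGmul n).
Proof. by move=> x; rewrite /FGmul /= cats0 FG_of_val. Qed.

Lemma FGmulrV : right_inverse (FGone n) (FGinv n) (FGmul n).
Proof.
move=> x; rewrite /FGinv -{1}[x]FG_of_val -FG_of_cat; apply: val_inj => /=.
elim: (val x) => [|a u IH] //=.
rewrite rev_cons -cats1 catA -/(flip a) -reduce_catl IH /=.
by rewrite cancelsE eqxx.
Qed.

Lemma FGmulV : left_inverse (FGone n) (FGinv n) (FGmul n).
Proof.
move=> x; rewrite -[LHS]FGmulr1 -{1}(FGmulrV (FGinv n x)) -FGmulA.
by rewrite [FGmul n x _]FGmulA FGmulrV FGmul1 FGmulrV.
Qed.

HB.instance Definition _ :=
  Choice.copy (FG n) {w : seq (letter n) | reduced n w}.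
HB.instance Definition _ :=
  isGroup.Build (FG n) FGmulA FGmul1 FGmulr1 FGmulV FGmulrV.

Lemma FGmulE x y : FGmul n x y = x * y. Proof. by []. Qed.
Lemma FGinvE x : FGinv n x = x^-1. Proof. by []. Qed.
Lemma FG_of_letter a :
  FG_of n [:: a] = if a.2 then (FGgen n a.1)^-1 else FGgen n a.1.
Proof. by case: a => i [] //; apply: val_inj. Qed.

(** Universal property of the free group in the form of a fold. It serves both for endomorphisms and
    for the Magnus expansion. *)
Lemma foldr_reduce (T : Type) (act : letter n -> T -> T) t u :
    (forall a s, act a (act (flip a) s) = s) ->
  foldr act t (reduce n u) = foldr act t u.
Proof.
move=> actK; elim: u => [|a u IH] //=; rewrite -IH.
case: (reduce n u) => [|b v] //=; rewrite cancelsE.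
by case: eqP => //= ->; rewrite actK.
Qed.

Lemma FG_ind (P : FG n -> Prop) :
    P 1 -> (forall i x, P x -> P (FGgen n i * x)) ->
    (forall i x, P x -> P ((FGgen n i)^-1 * x)) ->
  forall x, P x.
Proof.
move=> P1 PM PV x; rewrite -[x]FG_of_val; elim: (val x) => [|a u IH].
  by rewrite (_ : FG_of n [::] = 1) //; apply: val_inj.
rewrite -cat1s FG_of_cat FG_of_letter.
by case: a.2; [apply: PV | apply: PM].
Qed.

End FreeGroup.

Section Endomorphisms.
Variable n : nat.
Implicit Types (f g h : End_ n) (x y : FG n).

Lemma evalE_of f u :
  evalE n f (FG_of n u) = foldr (fun a => FGmul n (img n f a)) 1 u.
Proof.
apply: foldr_reduce => -[i b] x; rewrite /img /= !FGmulE.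
by case: b; rewrite /= FGinvE ?mulKg ?mulVKg.
Qed.

Lemma evalEM f : {morph evalE n f : x y / x * y}.
Proof.
move=> x y; rewrite -[x]FG_of_val -[y]FG_of_val -FGmulE -FG_of_cat !evalE_of.
by elim: (val x) => [|a u /= ->]; rewrite /= ?mul1g // !FGmulE mulgA.
Qed.

Lemma evalE1 f : evalE n f 1 = 1.
Proof. by []. Qed.

Lemma evalEV f x : evalE n f x^-1 = (evalE n f x)^-1.
Proof. by apply/esym/mulg1_eq; rewrite -evalEM mulgV. Qed.

Lemma evalE_gen f i : evalE n f (FGgen n i) = f i.
Proof. by rewrite evalE_of /= FGmulE mulg1. Qed.

Lemma evalE_id x : evalE n (idE n) x = x.
Proof.
elim/FG_ind: x => [|i x IH|i x IH]; rewrite ?evalE1 // evalEM ?evalEV evalE_gen.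
  by rewrite ffunE IH.
by rewrite ffunE IH.
Qed.

Lemma evalE_comp f g x : evalE n (compE n f g) x = evalE n f (evalE n g x).
Proof.
elim/FG_ind: x => [|i x IH|i x IH]; first by rewrite !evalE1.
  by rewrite (evalEM (compE n f g)) IH evalE_gen ffunE (evalEM g) evalE_gen evalEM.
rewrite (evalEM (compE n f g)) IH (evalEM g) (evalEM f) !evalEV.
by rewrite !evalE_gen ffunE.
Qed.

Lemma compEA : associative (compE n).
Proof. by move=> f g h; apply/ffunP => i; rewrite !ffunE evalE_comp. Qed.

Lemma comp1E : left_id (idE n) (compE n).
Proof. by move=> f; apply/ffunP => i; rewrite ffunE evalE_id. Qed.

Lemma compE1 : right_id (idE n) (compE n).
Proof. by move=> f; apply/ffunP => i; rewrite !ffunE evalE_gen. Qed.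

Lemma isinvE_sym f g : isinvE n f g -> isinvE n g f.
Proof. by case. Qed.

Lemma isinvE_uniq f g h : isinvE n f g -> isinvE n f h -> g = h.
Proof.
by move=> [_ gf] [fh _]; rewrite -[g]compE1 -fh compEA gf comp1E.
Qed.

Lemma isinvE_comp f f' g g' :
  isinvE n f f' -> isinvE n g g' -> isinvE n (compE n f g) (compE n g' f').
Proof.
move=> [ff' f'f] [gg' g'g]; split.
  by rewrite -compEA [compE n g _]compEA gg' comp1E.
by rewrite -compEA [compE n f' _]compEA f'f comp1E.
Qed.

Lemma isinvE_id : isinvE n (idE n) (idE n).
Proof. by split; rewrite comp1E. Qed.

Lemma isinvE_can f g : isinvE n f g -> cancel (evalE n f) (evalE n g).
Proof. by case=> _ gf x; rewrite -evalE_comp gf evalE_id. Qed.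

Lemma isinvE_isAut f g : isinvE n f g -> isAut n f.
Proof.
by move=> fg; exists (evalE n g); apply: isinvE_can; last exact: isinvE_sym.
Qed.

Lemma gamma_evalE k f x : gamma k x -> gamma k (evalE n f x).
Proof.
elim: k x => [|[|k] IH] // x; rewrite gammaSS.
apply: (generated_min (H := fun x => gamma k.+2 (evalE n f x))).
  split=> [|y z|y]; rewrite ?evalE1 ?evalEM ?evalEV; first exact: gamma1.
    exact: gammaM.
  exact: gammaV.
move=> _ [a [b [_ [_ [Ha _ -> -> ->]]]]].
rewrite !evalEM !evalEV -!mulgA -[_ * (_ * (_ * _))]/[~ _, _].
exact/gamma_comm1/IH.
Qed.

End Endomorphisms.

(** * Noncommutative power series and the Magnus expansion *)

Local Open Scope ring_scope.

(** A series is its coefficient function on words in noncommuting variables. The name keeps the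
    product of series apart from the pointwise product of functions. *)
Definition ncseries (A : Type) := seq A -> int.

HB.instance Definition _ (A : Type) :=
  GRing.Zmodule.copy (ncseries A) (seq A -> int).

Section NoncommutativeSeries.
Variable A : eqType.
Implicit Types (f g h : ncseries A) (u v w : seq A).

Definition nc1 : ncseries A := fun w => (w == [::])%:R.

Definition nc_mul f g : ncseries A :=
  fun w => \sum_(i < (size w).+1) f (take i w) * g (drop i w).

(** Left quotient by a letter; it allows products to be computed by recursion on the first letter of
    a word. *)
Definition nc_shift a f : ncseries A := fun u => f (a :: u).

Lemma nc_mul_nil f g : nc_mul f g [::] = f [::] * g [::].
Proof. by rewrite /nc_mul big_ord_recl big_ord0 addr0. Qed.

Lemma nc_mul_cons f g a w :
  nc_mul f g (a :: w) =
  f [::] * g (a :: w) + nc_mul (nc_shift a f) g w.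
Proof. by rewrite /nc_mul big_ord_recl. Qed.

Lemma nc_mulDl : left_distributive nc_mul +%R.
Proof.
move=> f g h; apply/funext => w; etransitivity; last exact: big_split.
by apply: eq_bigr => i _; exact: mulrDl.
Qed.

Lemma nc_mulDr : right_distributive nc_mul +%R.
Proof.
move=> f g h; apply/funext => w; etransitivity; last exact: big_split.
by apply: eq_bigr => i _; exact: mulrDr.
Qed.

Lemma nc_mul_scale (c : int) f g w :
  nc_mul (fun u => c * f u) g w = c * nc_mul f g w.
Proof. by rewrite /nc_mul mulr_sumr; apply: eq_bigr => i _; rewrite mulrA. Qed.

Lemma nc_mulA : associative nc_mul.
Proof.
move=> f g h; apply/funext => w.
elim: w f => [|a w IH] f; first by rewrite !nc_mul_nil mulrA.
rewrite !nc_mul_cons !nc_mul_nil IH mulrDr mulrA -addrA; congr (_ + _).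
rewrite (_ : nc_shift a (nc_mul f g) =
  (fun u => f [::] * g (a :: u)) + nc_mul (nc_shift a f) g).
  by rewrite nc_mulDl -nc_mul_scale.
by apply/funext => u; rewrite /nc_shift nc_mul_cons.
Qed.

Lemma nc_mul1 : left_id nc1 nc_mul.
Proof.
move=> f; apply/funext => w; rewrite /nc_mul big_ord_recl /= take0 drop0 mul1r.
rewrite big1 ?addr0 // => i _; case: w i => [|a w] [i lti] //.
by rewrite /nc1 /= mul0r.
Qed.

Lemma nc_mulr1 : right_id nc1 nc_mul.
Proof.
move=> f; apply/funext => w; elim: w f => [|a w IH] f.
  by rewrite nc_mul_nil mulr1.
by rewrite nc_mul_cons IH mulr0 add0r.
Qed.

HB.instance Definition _ := GRing.Zmodule_isPzRing.Build (ncseries A)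
  nc_mulA nc_mul1 nc_mulr1 nc_mulDl nc_mulDr.

Lemma ncD f g w : (f + g) w = f w + g w. Proof. by []. Qed.
Lemma ncB f g w : (f - g) w = f w - g w. Proof. by []. Qed.
Lemma ncN f w : (- f) w = - f w. Proof. by []. Qed.
Lemma nc1E w : (1 : ncseries A) w = (w == [::])%:R. Proof. by []. Qed.
Lemma ncM_nil f g : (f * g) [::] = f [::] * g [::].
Proof. exact: nc_mul_nil. Qed.

Lemma ncM_cons f g a w :
  (f * g) (a :: w) = f [::] * g (a :: w) + (nc_shift a f * g) w.
Proof. exact: nc_mul_cons. Qed.

Lemma ncM_eq0 f g w :
  (forall u v, w = u ++ v -> f u * g v = 0) -> (f * g) w = 0.
Proof.
by move=> fg0; apply: big1 => i _; apply: fg0; rewrite cat_take_drop.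
Qed.

Lemma ncM_single f g u v :
    (forall u' v', u ++ v = u' ++ v' -> u' <> u -> f u' * g v' = 0) ->
  (f * g) (u ++ v) = f u * g v.
Proof.
move=> fg0; have ltu : (size u < (size (u ++ v)).+1)%N.
  by rewrite size_cat ltnS leq_addr.
rewrite [LHS](bigD1 (Ordinal ltu)) //= take_size_cat // drop_size_cat //.
rewrite big1 ?addr0 // => i neqi; apply: fg0; first by rewrite cat_take_drop.
move/(congr1 size); rewrite size_take_min => Ei; case/negP: neqi.
by apply/eqP/val_inj => /=; move: (ltn_ord i) Ei; rewrite ltnS; lia.
Qed.

(* [f] lies in the [d]-th power of the augmentation ideal. *)
Definition ord_ge (d : nat) f := forall w, (size w < d)%N -> f w = 0.

Lemma ord_ge0 d : ord_ge d 0. Proof. by []. Qed.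

Lemma ord_geD d f g : ord_ge d f -> ord_ge d g -> ord_ge d (f + g).
Proof. by move=> Hf Hg w Hw; rewrite ncD Hf // Hg. Qed.

Lemma ord_geN d f : ord_ge d f -> ord_ge d (- f).
Proof. by move=> Hf w Hw; rewrite ncN Hf ?oppr0. Qed.

Lemma ord_geB d f g : ord_ge d f -> ord_ge d g -> ord_ge d (f - g).
Proof. by move=> Hf Hg; apply/ord_geD/ord_geN. Qed.

Lemma ord_ge_le d e f : (d <= e)%N -> ord_ge e f -> ord_ge d f.
Proof. by move=> le_de Hf w Hw; apply/Hf/(leq_trans Hw). Qed.

Lemma ord_geM d e f g : ord_ge d f -> ord_ge e g -> ord_ge (d + e) (f * g).
Proof.
move=> Hf Hg w Hw; apply: ncM_eq0 => u v E; move: Hw; rewrite E size_cat.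
have [/Hf -> _|le_du Hw] := ltnP (size u) d; first by rewrite mul0r.
by rewrite Hg ?mulr0 //; lia.
Qed.

Lemma ord_geMl d f g : ord_ge d g -> ord_ge d (f * g).
Proof. by rewrite -[d in ord_ge d (_ * _)]add0n; apply: ord_geM. Qed.

Lemma ord_geMr d f g : ord_ge d f -> ord_ge d (f * g).
Proof. by move=> Hf; rewrite -[d]addn0; apply: ord_geM. Qed.

End NoncommutativeSeries.

Section MagnusExpansion.
Variable n : nat.
Implicit Types (x y z : FG n) (w : seq 'I_n).

(** The generator [x_i] goes to [1 + X_i], and its inverse to the geometric series
    [1 - X_i + X_i^2 - ...]. *)
Definition magnus_letter (a : letter n) : ncseries 'I_n := fun w =>
  if a.2 then if all (pred1 a.1) w then (-1) ^+ size w else 0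
  else ((w == [::]) || (w == [:: a.1]))%:R.

Definition magnus x : ncseries 'I_n :=
  foldr (fun a f => magnus_letter a * f) 1 (val x).

Lemma magnus_letterK a : magnus_letter a * magnus_letter (flip a) = 1.
Proof.
case: a => i []; apply/funext; last first.
  case=> [|a w]; first by rewrite ncM_nil.
  rewrite ncM_cons mul1r nc1E /=.
  rewrite (_ : nc_shift _ _ = if a == i then 1 else 0); last first.
    apply/funext => u; rewrite /nc_shift /magnus_letter /= eqseq_cons.
    by case: (a =P i) => //= _; rewrite nc1E.
  rewrite /magnus_letter /=; case: (a =P i) => [_|_] /=.
    by rewrite mul1r /= exprS; case: all; rewrite ?addr0 ?mulN1r ?addNr.
  by rewrite add0r mul0r.
elim=> [|a w IH]; first by rewrite ncM_nil.
rewrite ncM_cons mul1r nc1E /=.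
rewrite (_ : nc_shift _ _ =
  if a == i then - magnus_letter (i, true) else 0); last first.
  apply/funext => u; rewrite /nc_shift /magnus_letter /=; case: (a =P i) => //= _.
  by rewrite ncN /=; case: all; rewrite ?oppr0 // exprS mulN1r.
rewrite /magnus_letter /= eqseq_cons; case: (a =P i) => [_|_] /=; last first.
  by rewrite mul0r.
by rewrite mulNr ncN IH nc1E subrr.
Qed.

Lemma magnus_of u :
  magnus (FG_of n u) = foldr (fun a f => magnus_letter a * f) 1 u.
Proof.
apply: foldr_reduce => a f.
by rewrite mulrA magnus_letterK mul1r.
Qed.

Lemma magnus1 : magnus 1%g = 1. Proof. by []. Qed.

Lemma magnusM x y : magnus (x * y)%g = magnus x * magnus y.
Proof.
rewrite -[x]FG_of_val -[y]FG_of_val -FGmulE -FG_of_cat !magnus_of.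
by elim: (val x) => [|a u /= ->]; rewrite /= ?mul1r // mulrA.
Qed.

Lemma magnusV x : magnus x^-1%g * magnus x = 1.
Proof. by rewrite -magnusM mulVg. Qed.

Lemma magnus_gen i w : magnus (FGgen n i) w = ((w == [::]) || (w == [:: i]))%:R.
Proof. by rewrite magnus_of /= mulr1. Qed.

Lemma magnus_nil x : magnus x [::] = 1.
Proof.
rewrite /magnus; elim: (val x) => [|a u IH] //=.
by rewrite ncM_nil IH /magnus_letter; case: a.2.
Qed.

Lemma magnus_ord1 x : ord_ge 1 (magnus x - 1).
Proof. by case=> // _; rewrite ncB magnus_nil nc1E subrr. Qed.

Lemma magnusM_sub1 x y :
  magnus (x * y)%g - 1 = (magnus x - 1) * magnus y + (magnus y - 1).
Proof. by rewrite magnusM mulrBl mul1r addrA subrK. Qed.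

Lemma magnusV_sub1 x : magnus x^-1%g - 1 = - (magnus x^-1%g * (magnus x - 1)).
Proof. by rewrite mulrBr mulr1 magnusV opprB. Qed.

(** Used to estimate brackets: the factors on the right lie in the augmentation ideal, so their
    orders add up. *)
Lemma comm_sub1 (R : pzRingType) (a b : R) :
  a * b - b * a = (a - 1) * (b - 1) - (b - 1) * (a - 1).
Proof.
have E (x y : R) : (x - 1) * (y - 1) = x * y - (x + y - 1).
  by rewrite mulrBl mul1r mulrBr mulr1 -addrA -opprD addrA.
by rewrite !E [b + a]addrC; move: (a + b - 1) => c; rewrite opprB addrA subrK.
Qed.

(** Turns a group commutator into a bilinear bracket, up to a factor with constant term 1 that
    affects neither orders nor leading words. *)
Lemma magnus_comm x y :
  magnus [~ x, y]%g - 1 =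
  magnus (y * x)^-1%g * (magnus x * magnus y - magnus y * magnus x).
Proof.
rewrite -!magnusM mulrBr -!magnusM mulVg; congr (magnus _ - _).
by rewrite /commg /conjg invgM !mulgA.
Qed.

Lemma magnus_ord_subgroup k : is_subgroup (fun x => ord_ge k (magnus x - 1)).
Proof.
split=> [|x y Hx Hy|x Hx].
- by rewrite magnus1 subrr; apply: ord_ge0.
- by rewrite magnusM_sub1; apply/ord_geD => //; apply: ord_geMr.
by rewrite magnusV_sub1; apply/ord_geN/ord_geMl.
Qed.

(** The easy half of Magnus' theorem; the converse is [magnus_ord_gamma]. *)
Lemma gamma_magnus_ord k x : gamma k x -> ord_ge k (magnus x - 1).
Proof.
elim: k x => [|[|k] IH] // x; first by move=> _; apply: magnus_ord1.
rewrite gammaSS; apply: (generated_min (magnus_ord_subgroup k.+2)).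
move=> _ [a [b [_ [_ [Ha _ -> -> ->]]]]].
rewrite -!mulgA -[(_ * (_ * _))%g]/[~ a, b]%g magnus_comm comm_sub1.
apply/ord_geMl/ord_geB.
  by rewrite -[k.+2]addn1; apply: ord_geM; [apply: IH | apply: magnus_ord1].
by rewrite -[k.+2]add1n; apply: ord_geM; [apply: magnus_ord1 | apply: IH].
Qed.

End MagnusExpansion.

(** * Leading words *)

Section WordOrder.
Variable n : nat.
Implicit Types (a : 'I_n) (u v w : seq 'I_n).

(* The digits are shifted to [1 .. n], so that in base [n + 1] the numeral of a
   word determines it, and comparing numerals is comparing words by length and
   then lexicographically. *)
Definition key w : nat := foldl (fun k (a : 'I_n) => k * n.+1 + a.+1)%N 0%N w.

Lemma key_rcons w a : key (rcons w a) = (key w * n.+1 + a.+1)%N.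
Proof. by rewrite /key -cats1 foldl_cat. Qed.

Lemma key_cat u v : key (u ++ v) = (key u * n.+1 ^ size v + key v)%N.
Proof.
elim/last_ind: v => [|v a IH]; first by rewrite cats0 muln1 addn0.
by rewrite -rcons_cat !key_rcons IH size_rcons expnSr mulnDl -mulnA addnA.
Qed.

Lemma key_lt w : (key w < n.+1 ^ size w)%N.
Proof.
elim: w => [|a w IH] //; rewrite -cat1s key_cat size_cat expnD expn1 /key /= -/(key w).
move: IH (ltn_ord a); set m := (_ ^ _)%N => IH lta; nia.
Qed.

Lemma key_cons_ge a w : (n.+1 ^ size w <= key (a :: w))%N.
Proof. by rewrite -cat1s key_cat /key /=; nia. Qed.

Lemma key_size_lt u v : (size u < size v)%N -> (key u < key v)%N.
Proof.
case: v => [|a v] //= Huv; apply: leq_trans (key_lt u) _.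
by apply: leq_trans (key_cons_ge a v); rewrite leq_pexp2l.
Qed.

Lemma key_le_size u v : (key u <= key v)%N -> (size u <= size v)%N.
Proof. by apply: contraTT; rewrite -!ltnNge; apply: key_size_lt. Qed.

Lemma key_inj : injective key.
Proof.
move=> u v E; have Es : size u = size v.
  by apply/eqP; rewrite eqn_leq !key_le_size // E.
elim: u v E Es => [|a u IH] [|b v] //=; rewrite -[a :: u]cat1s -[b :: v]cat1s.
rewrite !key_cat /key /= -!/(key _) => + [Es]; rewrite Es => E.
have := key_lt u; have := key_lt v; rewrite Es => Hv Hu.
have Eab : a = b.
  apply: val_inj; move: E Hu Hv; set m := (_ ^ _)%N.
  have [ltab|ltba|//] := ltngtP (a : nat) b.
    have : ((val a).+1.+1 * m <= b.+1 * m)%N by apply: leq_mul.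
    rewrite /=; nia.
  have : ((val b).+1.+1 * m <= a.+1 * m)%N by apply: leq_mul.
  rewrite /=; nia.
by move: E; rewrite Eab => /addnI /IH ->.
Qed.

Lemma key_cat_le u u' v v' :
  (key u <= key u')%N -> (key v <= key v')%N ->
  (key (u ++ v) <= key (u' ++ v'))%N.
Proof.
move=> Hu Hv; rewrite !key_cat leq_add // leq_mul // leq_pexp2l //.
exact: key_le_size.
Qed.

Lemma key_catl_lt u v w :
  size v = size w -> (key (u ++ v) < key (u ++ w))%N = (key v < key w)%N.
Proof. by move=> Evw; rewrite !key_cat Evw ltn_add2l. Qed.

(* On nonempty words this compares the infinite periodic words [u u u ...]
   and [v v v ...], whence transitivity. *)
Definition prec u v : bool := (key (u ++ v) < key (v ++ u))%N.

Lemma prec_total u v : u ++ v <> v ++ u -> prec u v \/ prec v u.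
Proof.
rewrite /prec => neq; case: (ltngtP (key (u ++ v)) (key (v ++ u))); auto.
by move/key_inj.
Qed.

Lemma prec_trans u v w : v <> [::] -> prec u v -> prec v w -> prec u w.
Proof.
rewrite /prec !key_cat; case: v => [//|a v] _.
have := key_cons_ge a v; set kv := key _.
have gt0 m : (0 < n.+1 ^ m)%N by rewrite expn_gt0.
have : (1 < n.+1 ^ size (a :: v))%N.
  by rewrite -(expn0 n.+1) ltn_exp2l // ltnS (leq_ltn_trans _ (ltn_ord a)).
move: (gt0 (size u)) (gt0 (size w)); move: (key u) (key w) => x z.
case: (_ ^ size u)%N => // p _; case: (_ ^ size w)%N => // r _.
case: (_ ^ size (a :: v))%N => [|[|q]] // _ _.
rewrite !mulnS => Huv Hvw.
(* [prec u v] compares the quotients [key u / ((n+1)^(size u) - 1)], the values of periodic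
   fractions in base [n+1]. The denominators [p], [q.+1] and [r] are cleared, since [p] and [r] may
   be zero. *)
have {}Huv : (x * q.+1 < kv * p)%N by lia.
have {}Hvw : (kv * r < z * q.+1)%N by lia.
suff : (x * r < z * p)%N by lia.
have [r0|r0] := posnP r.
  case: p Huv => [|p]; first by lia.
  by move=> _; move: Hvw; rewrite r0; case: z => [|z]; lia.
have [p0|p0] := posnP p; first by lia.
have H1 : (x * q.+1 * r < kv * p * r)%N by rewrite ltn_pmul2r.
have H2 : (kv * r * p < z * q.+1 * p)%N by rewrite ltn_pmul2r.
rewrite -(ltn_pmul2r (ltn0Sn q)); lia.
Qed.

(** On nonempty, pairwise non-commuting words [prec] is a strict total order, and a code consists of
    such words. The list [W] provides finiteness. *)
Lemma prec_min (P : seq 'I_n -> Prop) (W : seq (seq 'I_n)) :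
    (forall u, P u -> u <> [::]) ->
    (forall u v, P u -> P v -> u <> v -> u ++ v <> v ++ u) ->
    (forall u, P u -> u \in W) -> (exists u, P u) ->
  exists u, P u /\ forall v, P v -> v <> u -> prec u v.
Proof.
elim: W P => [|a W IH] P Pn0 Pcomm PW [u0 Pu0]; first by have := PW _ Pu0.
have [[u [Pu neua]]|none] := pselect (exists u, P u /\ u <> a); last first.
  have all_a v : P v -> v = a by move=> Pv; apply: contrapT => ?; apply: none; exists v.
  by exists u0; split=> // v /all_a ->; rewrite (all_a _ Pu0).
have [||||m [[Pm neqma] minm]] := IH (fun u => P u /\ u <> a).
- by move=> v [/Pn0].
- by move=> v w [Pv _] [Pw _]; apply: Pcomm.
- by move=> v [/PW]; rewrite inE => /orP[/eqP|].
- by exists u.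
have [Pa|nPa] := pselect (P a); last first.
  exists m; split=> // v Pv nevm; apply: minm => //; split=> // Eva.
  by rewrite Eva in Pv.
have [am|ma] := prec_total (Pcomm _ _ Pa Pm (nesym neqma)).
  exists a; split=> // v Pv neva; have [->//|nevm] := pselect (v = m).
  by apply: prec_trans am (minm _ _ _) => //; apply: Pn0.
exists m; split=> // v Pv nevm; have [->//|neva] := pselect (v = a).
exact: minm.
Qed.

End WordOrder.

Section LeadingWords.
Variable n : nat.
Implicit Types (u v w l : seq 'I_n) (f g : ncseries 'I_n) (x y z : FG n).

Definition low l f := forall v, (key v < key l)%N -> f v = 0.

Lemma low_le l l' f : (key l <= key l')%N -> low l' f -> low l f.
Proof. by move=> le_ll' Hf v Hv; apply/Hf/(leq_trans Hv). Qed.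

Lemma lowM u v f g : low u f -> low v g -> low (u ++ v) (f * g).
Proof.
move=> Hf Hg w Hw; apply: ncM_eq0 => u' v' E.
have [/Hf->|le_u] := ltnP (key u') (key u); first by rewrite mul0r.
have [/Hg->|le_v] := ltnP (key v') (key v); first by rewrite mulr0.
by move: Hw; rewrite E ltnNge key_cat_le.
Qed.

(** Any other splitting of [u ++ v] has a shorter left or right factor, whose key is smaller, so
    that its coefficient vanishes. *)
Lemma low_coefM u v f g : low u f -> low v g -> (f * g) (u ++ v) = f u * g v.
Proof.
move=> Hf Hg; apply: ncM_single => u' v' E ne.
have Es := congr1 size E; rewrite !size_cat in Es.
have [lt_u|lt_u|eq_u] := ltngtP (size u') (size u).
- by rewrite Hf ?mul0r //; apply: key_size_lt.
- rewrite Hg ?mulr0 //; apply: key_size_lt.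
  by rewrite -(ltn_add2l (size u)) Es ltn_add2r.
by case: ne; have /eqP := E; rewrite eqseq_cat ?eq_u // => /andP[/eqP].
Qed.

Lemma lowMl l f g : low l g -> low l (f * g).
Proof. exact: (@lowM [::]). Qed.

Lemma low_coefMl l f g : low l g -> (f * g) l = f [::] * g l.
Proof. exact: (@low_coefM [::]). Qed.

Lemma lowMr l f g : low l f -> low l (f * g).
Proof. by move=> Hf; rewrite -[l]cats0; apply: lowM. Qed.

Lemma low_coefMr l f g : low l f -> (f * g) l = f l * g [::].
Proof. by move=> Hf; rewrite -[l in LHS]cats0 low_coefM. Qed.

Definition mlow l x := low l (magnus x - 1).
Definition mcoef l x := (magnus x - 1) l.
(* [l] is the first nonempty word, by length and then lexicographically, in the
   support of the Magnus expansion of [x]. *)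
Definition mlead l x := mlow l x /\ mcoef l x <> 0.

Lemma mlow1 l : mlow l 1%g. Proof. by move=> w _; rewrite magnus1 subrr. Qed.
Lemma mcoef1 l : mcoef l 1%g = 0. Proof. by rewrite /mcoef magnus1 subrr. Qed.

Lemma mlowM l x y : mlow l x -> mlow l y -> mlow l (x * y)%g.
Proof.
by move=> Hx Hy w Hw; rewrite magnusM_sub1 ncD Hy // addr0; apply: lowMr Hw.
Qed.

Lemma mcoefM l x y : mlow l x -> mcoef l (x * y)%g = mcoef l x + mcoef l y.
Proof.
by move=> Hx; rewrite /mcoef magnusM_sub1 ncD low_coefMr // magnus_nil mulr1.
Qed.

Lemma mlowV l x : mlow l x -> mlow l x^-1%g.
Proof. by move=> Hx w Hw; rewrite magnusV_sub1 ncN (lowMl _ Hx Hw) oppr0. Qed.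

Lemma mcoefV l x : mlow l x -> mcoef l x^-1%g = - mcoef l x.
Proof.
by move=> Hx; rewrite /mcoef magnusV_sub1 ncN low_coefMl // magnus_nil mul1r.
Qed.

Lemma mlowX l x m : mlow l x -> mlow l (x ^+ m)%g.
Proof.
move=> Hx; elim: m => [|m IH]; first exact: mlow1.
by rewrite expgS; apply: mlowM.
Qed.

Lemma mcoefX l x m : mlow l x -> mcoef l (x ^+ m)%g = mcoef l x *+ m.
Proof.
move=> Hx; elim: m => [|m IH]; first exact: mcoef1.
by rewrite expgS mcoefM // IH mulrS.
Qed.

Lemma mlow_lt l l' x : (key l < key l')%N -> mlow l' x -> mlow l x /\ mcoef l x = 0.
Proof. by move=> lt Hx; split; [apply: low_le Hx; apply: ltnW | apply: Hx]. Qed.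

Lemma gamma_mlow k l x :
  (size l < k)%N -> gamma k x -> mlow l x /\ mcoef l x = 0.
Proof.
move=> Hl /gamma_magnus_ord Hx; split; last exact: Hx.
by move=> w /ltnW/key_le_size Hw; apply/Hx/(leq_ltn_trans Hw).
Qed.

Lemma mleadMl l x y : mlead l x -> mlow l y /\ mcoef l y = 0 -> mlead l (x * y)%g.
Proof.
by move=> [Hx cx] [Hy cy]; split; [apply: mlowM | rewrite mcoefM // cy addr0].
Qed.

Lemma mleadMr l x y : mlow l x /\ mcoef l x = 0 -> mlead l y -> mlead l (x * y)%g.
Proof.
by move=> [Hx cx] [Hy cy]; split; [apply: mlowM | rewrite mcoefM // cx add0r].
Qed.

(** In the bracket the words [u ++ v] and [v ++ u] compete. By [prec v u] the second one is smaller,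
    and its coefficient is minus the product of two nonzero integers. *)
Lemma mlead_comm u v x y :
  mlead u x -> mlead v y -> prec v u -> mlead (v ++ u) [~ x, y]%g.
Proof.
move=> [Hx cx] [Hy cy] vu.
have Hxy : low (u ++ v) ((magnus x - 1) * (magnus y - 1)) by apply: lowM.
have Hyx : low (v ++ u) ((magnus y - 1) * (magnus x - 1)) by apply: lowM.
have Hd : low (v ++ u) (magnus x * magnus y - magnus y * magnus x).
  move=> w Hw; rewrite comm_sub1 ncB Hyx // Hxy ?subrr //.
  exact: ltn_trans Hw vu.
split; first by rewrite /mlow magnus_comm; apply: lowMl.
rewrite /mcoef magnus_comm low_coefMl // magnus_nil mul1r comm_sub1 ncB.
rewrite Hxy // low_coefM // sub0r; apply/eqP; rewrite oppr_eq0 mulf_neq0 //.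
  exact/eqP.
exact/eqP.
Qed.

Lemma mlead_gen (i : 'I_n) : mlead [:: i] (FGgen n i).
Proof.
split=> [w|]; last first.
  by rewrite /mcoef ncB magnus_gen nc1E eqxx.
have := key_le_size (u := w) (v := [:: i]).
case: w => [|a [|b w]] Hw lt; first by rewrite ncB magnus_gen nc1E.
  rewrite ncB magnus_gen nc1E /= eqseq_cons andbT.
  by case: eqP lt => [->|//]; rewrite ltnn.
by have := Hw (ltnW lt).
Qed.

End LeadingWords.

(** * Lazard elimination and Magnus' theorem *)

Section Codes.
Variable A : eqType.
Implicit Types (L : seq A -> Prop) (x u v w : seq A).

Definition over L (a : seq (seq A)) := forall u, u \in a -> L u.

Definition monomial L w := exists2 a, a <> [::] /\ over L a & w = flatten a.

Definition is_code L :=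
  forall a b, over L a -> over L b -> flatten a = flatten b -> a = b.

Lemma over_cons L u a : L u -> over L a -> over L (u :: a).
Proof. by move=> Lu La v; rewrite inE => /orP[/eqP->|/La]. Qed.

Lemma over1 L u : L u -> over L [:: u].
Proof. by move=> Lu; apply: over_cons. Qed.

Lemma over_cat L a b : over L a -> over L b -> over L (a ++ b).
Proof. by move=> La Lb u; rewrite mem_cat => /orP[/La|/Lb]. Qed.

Lemma monomial1 L u : L u -> monomial L u.
Proof. by move=> Lu; exists [:: u]; [split=> //; apply: over1 | rewrite /= cats0]. Qed.

Lemma code_neq0 L u : is_code L -> L u -> u <> [::].
Proof.
move=> codeL Lu u0; have L0 : over L [::] by [].
by have := codeL _ _ (over1 Lu) L0; rewrite u0 => /(_ erefl).
Qed.

Lemma code_comm L u v : is_code L -> L u -> L v -> u <> v -> u ++ v <> v ++ u.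
Proof.
move=> codeL Lu Lv neq E.
have := codeL [:: u; v] [:: v; u]; rewrite /= !cats0.
by case/(_ (over_cons Lu (over1 Lv)) (over_cons Lv (over1 Lu)) E).
Qed.

(** Lists of factors are kept apart from the words they spell: [block] lists the factors
    [x, .., x, u], while [elim_word] is their concatenation, the leading word of an iterated
    commutator. *)
Definition block x (q : nat * seq A) := rcons (nseq q.1 x) q.2.

Definition elim_word x (q : nat * seq A) := flatten (block x q).

Definition elim_words x L w :=
  exists2 q, L q.2 /\ q.2 <> x & w = elim_word x q.

Lemma over_block x L q : L x -> L q.2 -> over L (block x q).
Proof.
move=> Lx Lq u; rewrite mem_rcons inE => /orP[/eqP->//|].
by rewrite mem_nseq => /andP[_ /eqP->].
Qed.

(** A block ends at its first factor different from [x], so the blocks form a prefix code over the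
    alphabet of factors. *)
Lemma blocks_inj x (p q : seq (nat * seq A)) :
    (forall c, c \in p -> c.2 <> x) -> (forall c, c \in q -> c.2 <> x) ->
  flatten (map (block x) p) = flatten (map (block x) q) -> p = q.
Proof.
have behead (c : nat * seq A) r : (forall d, d \in c :: r -> d.2 <> x) ->
    c.2 <> x /\ (forall d, d \in r -> d.2 <> x).
  by move=> H; split=> [|d Hd]; apply: H; rewrite inE ?eqxx // Hd orbT.
elim: p q => [|[m u] p IH] [|[l v] q] //; rewrite /= /block /=.
- by move=> _ _ /(congr1 size); rewrite size_cat size_rcons.
- by move=> _ _ /(congr1 size); rewrite size_cat size_rcons.
move=> /behead[/= neu Hp] /behead[/= nev Hq].
rewrite !cat_rcons; elim: m l => [|m IHm] [|l] //=.
- by case=> -> /(IH _ Hp Hq) ->.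
- by case=> /neu.
- by case=> /esym/nev.
by case=> /IHm [-> -> ->].
Qed.

Lemma over_elim_words x L a :
    over (elim_words x L) a ->
  exists2 p, (forall c, c \in p -> L c.2 /\ c.2 <> x) & a = map (elim_word x) p.
Proof.
elim: a => [|u a IH] H; first by exists [::].
have [|p Hp ->] := IH; first by move=> v Hv; apply: H; rewrite inE Hv orbT.
have [q Hq ->] := H u (mem_head _ _); exists (q :: p) => // c.
by rewrite inE => /orP[/eqP->|/Hp].
Qed.

Lemma flatten_elim_word x p :
  flatten (map (elim_word x) p) = flatten (flatten (map (block x) p)).
Proof. by elim: p => //= q p ->; rewrite flatten_cat. Qed.

Lemma over_blocks x L p :
    L x -> (forall c, c \in p -> L c.2 /\ c.2 <> x) ->
  over L (flatten (map (block x) p)).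
Proof.
move=> Lx; elim: p => [|q p IH] Hp //=; apply: over_cat.
  by apply: over_block => //; case: (Hp q (mem_head _ _)).
by apply: IH => c Hc; apply: Hp; rewrite inE Hc orbT.
Qed.

(** Composition of codes: a word determines its factors in [L], and these determine the blocks. *)
Lemma code_elim x L : L x -> is_code L -> is_code (elim_words x L).
Proof.
move=> Lx codeL a b /over_elim_words[p Hp ->] /over_elim_words[q Hq ->].
rewrite !flatten_elim_word => /codeL H; congr map.
apply: (@blocks_inj x) => [c /Hp[]|c /Hq[]|] //.
by apply: H; apply: over_blocks.
Qed.

Lemma elim_word_inj x L p q :
    L x -> is_code L -> L p.2 -> p.2 <> x -> L q.2 -> q.2 <> x ->
  elim_word x p = elim_word x q -> p = q.
Proof.
move=> Lx codeL Lp np Lq nq E.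
suff [//] : [:: p] = [:: q].
apply: (@blocks_inj x) => [c|c|]; rewrite ?inE; try by move/eqP->.
by rewrite /= !cats0; apply: codeL => //; apply: over_block.
Qed.

Lemma monomial_elim x L w :
  L x -> monomial (elim_words x L) w -> monomial L w.
Proof.
move=> Lx [a [a0 /over_elim_words[p Hp Ea]] ->]; rewrite Ea flatten_elim_word.
exists (flatten (map (block x) p)); split=> //; last exact: over_blocks.
by move: a0; rewrite Ea; case: p {Hp Ea} => [|[[|m] u] p].
Qed.

(** The only factorisation of [x] over the code [L] is [x] itself, whereas every block ends in a
    factor other than [x]. This makes the elimination terminate. *)
Lemma monomial_elim_neq x L :
  L x -> is_code L -> ~ monomial (elim_words x L) x.
Proof.
move=> Lx codeL [a [a0 /over_elim_words[p Hp Ea]] E].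
move: E a0; rewrite {}Ea flatten_elim_word -{1}[x]cats0 -[x ++ [::]]/(flatten [:: x]).
move=> /codeL => /(_ (over1 Lx) (over_blocks Lx Hp)).
case: p Hp => [|[m u] p] // /(_ _ (mem_head _ _)) [_ /= neu].
case: m => [|m]; first by rewrite /= => -[/esym].
by move/(congr1 size); rewrite /= size_cat size_rcons.
Qed.

End Codes.

Section Elimination.
Variables (n k : nat).
Implicit Types (l u v w : seq 'I_n) (g x y z : FG n).
Implicit Type E : FG n -> seq 'I_n -> Prop.

Definition words E l := exists g, E g l.

(** Each element lies as deep in the lower central series as its leading word is long; a commutator
    whose leading word exceeds length [k] is therefore negligible. *)
Definition good_system E :=
  [/\ forall g l, E g l -> [/\ (size l <= k)%N, gamma (size l) g & mlead l g],
      forall g g' l, E g l -> E g' l -> g = g'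
    & is_code (words E)].

Definition span E : FG n -> Prop :=
  generated (fun g => (exists l, E g l) \/ gamma k.+1 g).

(** The elimination replaces [g] by the family of these commutators for all [m]. *)
Definition iter_comm x m g := iter m (fun y => [~ y, x]%g) g.

Definition elim_system x lx E : FG n -> seq 'I_n -> Prop := fun g' l' =>
  exists g l m, [/\ E g l, l <> lx, g' = iter_comm x m g,
                    l' = elim_word lx (m, l) & (size l' <= k)%N].

Lemma elim_word0 lx l : elim_word lx (0%N, l) = l.
Proof. by rewrite /elim_word /= cats0. Qed.

Lemma elim_wordS lx m l : elim_word lx (m.+1, l) = lx ++ elim_word lx (m, l).
Proof. by []. Qed.

(** Passing from a word [w] to [lx ++ w] preserves [prec lx w], as both sides of the comparison gain
    the prefix [lx]; thus [mlead_comm] applies again at each step. *)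
Lemma mlead_iter_comm x lx m g l :
  mlead lx x -> mlead l g -> prec lx l ->
  mlead (elim_word lx (m, l)) (iter_comm x m g) /\ prec lx (elim_word lx (m, l)).
Proof.
move=> Hx Hg lxl; elim: m => [|m [IH1 IH2]]; first by rewrite elim_word0.
rewrite elim_wordS; split; first exact: mlead_comm.
rewrite /prec -catA key_catl_lt //; last by rewrite !size_cat addnC.
Qed.

Lemma gamma_iter_comm x lx m g l :
    lx <> [::] -> l <> [::] -> gamma (size lx) x -> gamma (size l) g ->
  gamma (size (elim_word lx (m, l))) (iter_comm x m g).
Proof.
move=> lx0 l0 Hx Hg; elim: m => [|m IH]; first by rewrite elim_word0.
rewrite elim_wordS size_cat addnC.
have : elim_word lx (m, l) <> [::].
  by case: m {IH} => [|m]; rewrite ?elim_word0 // elim_wordS; case: (lx) lx0.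
move: IH; case: (elim_word lx (m, l)) => [|a w] // IH _.
case: (lx) lx0 Hx => [|b u] // _ Hx.
by rewrite /= addnS; apply: gamma_comm.
Qed.

Lemma size_elim_word lx m l : lx <> [::] -> (m <= size (elim_word lx (m, l)))%N.
Proof.
move=> lx0; elim: m => [|m IH] //; rewrite elim_wordS size_cat.
by case: (lx) lx0 IH => [|a u] //= _ IH; lia.
Qed.

Section Step.
Variables (E : FG n -> seq 'I_n -> Prop) (x : FG n) (lx : seq 'I_n).
Hypotheses (goodE : good_system E) (Ex : E x lx).
Hypothesis minx : forall l, words E l -> l <> lx -> prec lx l.

Let E' := elim_system x lx E.

Let Lx : words E lx. Proof. by exists x. Qed.

Let codeE : is_code (words E). Proof. by case: goodE. Qed.

Let lx0 : lx <> [::]. Proof. exact: code_neq0 Lx. Qed.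

Lemma words_elim_system l : words E' l -> elim_words lx (words E) l.
Proof.
by case=> _ [g [u [m [Eg neq _ -> _]]]]; exists (m, u) => //=; split=> //; exists g.
Qed.

Lemma monomial_elim_system l :
  monomial (words E') l -> monomial (elim_words lx (words E)) l.
Proof. by case=> a [a0 Ha] ->; exists a => //; split=> // u /Ha /words_elim_system. Qed.

Lemma good_elim_system : good_system E'.
Proof.
have [leadE funE _] := goodE; have [sx gx mx] := leadE _ _ Ex.
split.
- move=> _ _ [g [l [m [Eg neq -> -> Hs]]]]; have [sl gl ml] := leadE _ _ Eg.
  have Ll : words E l by exists g.
  split=> //; last by case: (mlead_iter_comm m mx ml (minx Ll neq)).
  by apply: gamma_iter_comm => //; apply: code_neq0 Ll.
- move=> _ _ _ [g [l [m [Eg neq -> -> Hs]]]] [g' [l' [m' [Eg' neq' -> Ew Hs']]]].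
  have [] : (m, l) = (m', l').
    by apply: (@elim_word_inj _ lx (words E)) => //; [exists g | exists g'].
  by move=> -> El; rewrite -El in Eg'; rewrite (funE _ _ _ Eg Eg').
move=> a b Ha Hb; apply: (code_elim Lx codeE) => u Hu; apply: words_elim_system.
  exact: Ha.
exact: Hb.
Qed.

Lemma span_iter_comm g l m : E g l -> l <> lx -> span E' (iter_comm x m g).
Proof.
move=> Eg neq; have [leadE _ _] := goodE; have [sx gx mx] := leadE _ _ Ex.
have [sl gl ml] := leadE _ _ Eg; have Ll : words E l by exists g.
apply: gen_base; have [Hs|Hs] := leqP (size (elim_word lx (m, l))) k.
  by left; exists (elim_word lx (m, l)), g, l, m.
right; apply: (gamma_le Hs); apply: gamma_iter_comm => //; exact: code_neq0 Ll.
Qed.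

Let spanP := generated_subgroup (fun g => (exists l, E' g l) \/ gamma k.+1 g).

Lemma span_conj g : span E' g -> span E' (g ^ x)%g.
Proof.
have [H1 HM HV] := spanP.
apply: (generated_min (H := fun g => span E' (g ^ x)%g)).
  split=> [|y z|y]; rewrite ?conj1g ?conjMg ?conjVg //; [exact: HM|exact: HV].
move=> y [[_ [h [l [m [Eh neq -> _ _]]]]]|Hy]; last first.
  by apply: gen_base; right; apply: gamma_conj.
have -> : (iter_comm x m h ^ x = iter_comm x m h * iter_comm x m.+1 h)%g.
  by rewrite /iter_comm iterS /commg mulVKg.
by apply: HM; apply: span_iter_comm Eh neq.
Qed.

(** Conjugating an iterated commutator by [x^-1] brings in the conjugate of the next one. The
    descending induction on [m] starts beyond [k], where the commutator lies in [gamma k.+1]. *)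
Lemma span_conjV g : span E' g -> span E' (g ^ x^-1)%g.
Proof.
have [H1 HM HV] := spanP; have [leadE _ _] := goodE.
apply: (generated_min (H := fun g => span E' (g ^ x^-1)%g)).
  split=> [|y z|y]; rewrite ?conj1g ?conjMg ?conjVg //; [exact: HM|exact: HV].
have gam y : gamma k.+1 y -> span E' (y ^ x^-1)%g.
  by move=> Hy; apply: gen_base; right; apply: gamma_conj.
move=> y [[_ [h [l [m [Eh neq -> _ _]]]]]|]; last exact: gam.
have [sx gx mx] := leadE _ _ Ex; have [sl gl ml] := leadE _ _ Eh.
have Ll : words E l by exists h.
elim: (k.+1 - m)%N {-2}m (leqnn (k.+1 - m)) => [|d IH] {}m Hd.
  apply: gam; apply: (@gamma_le _ _ (size (elim_word lx (m, l)))).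
    by apply: leq_trans (size_elim_word m l lx0); rewrite -subn_eq0 -leqn0.
  by apply: gamma_iter_comm => //; apply: code_neq0 Ll.
have -> : (iter_comm x m h ^ x^-1 =
           iter_comm x m h * (iter_comm x m.+1 h ^ x^-1)^-1)%g.
  exact: conjgV_commg.
apply: HM; first exact: span_iter_comm Eh neq.
by apply/HV/IH; lia.
Qed.

(** The powers of [x] normalise [span E'], so the products of the two form a group. Exponents being
    natural numbers, an integral power of [x] is coded by a pair [a], [b]. *)
Lemma span_elim g :
  span E g -> exists a b z, g = (x ^+ a * x^-1 ^+ b * z)%g /\ span E' z.
Proof.
have [H1 HM HV] := spanP; have [_ funE _] := goodE.
pose c a b := (x ^+ a * x^-1 ^+ b)%g.
have cM a b a' b' : (c a b * c a' b' = c (a + a')%N (b + b')%N)%g.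
  have comm i j : commute (x ^+ i)%g (x^-1 ^+ j)%g.
    by apply: commuteX2; apply: commuteV.
  rewrite /c !expgnDr !mulgA -[(_ * _ * x ^+ a')%g]mulgA -(comm a' b).
  by rewrite -!mulgA.
have c_conj a b z : span E' z -> span E' (z ^ c a b)%g.
  move=> Hz; rewrite conjgM; elim: b => [|b IH].
    rewrite conjg1; elim: a => [|a IH]; first by rewrite conjg1.
    by rewrite expgSr conjgM; apply: span_conj.
  by rewrite expgSr conjgM; apply: span_conjV.
apply: (generated_min (H := fun g =>
  exists a b z, g = (x ^+ a * x^-1 ^+ b * z)%g /\ span E' z)).
  split.
  - by exists 0%N, 0%N, 1%g; rewrite !mulg1.
  - move=> _ _ [a [b [z [-> Hz]]]] [a' [b' [z' [-> Hz']]]].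
    exists (a + a')%N, (b + b')%N, (z ^ c a' b' * z')%g.
    split; last by apply: HM => //; apply: c_conj.
    rewrite -!/(c _ _) -cM -[LHS]mulgA [(z * _)%g]mulgA [(z * _)%g]conjgC.
    by rewrite !mulgA.
  move=> _ [a [b [z [-> Hz]]]].
  exists b, a, (z^-1 ^ c b a)%g; split; last exact/c_conj/HV.
  rewrite -!/(c _ _); have -> : c b a = (c a b)^-1%g.
    by apply/esym/mulg1_eq; rewrite cM /c addnC expVgn mulgV.
  exact: invgM_conj.
move=> {}g [[l Eg]|Hg]; last first.
  by exists 0%N, 0%N, g; rewrite !mul1g; split=> //; apply: gen_base; right.
have [El|neq] := pselect (l = lx).
  exists 1%N, 0%N, 1%g; rewrite !mulg1; split=> //.
  by rewrite El in Eg; apply: funE Eg Ex.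
exists 0%N, 0%N, g; rewrite !mul1g; split=> //.
exact: (span_iter_comm 0 Eg neq).
Qed.

End Step.

Lemma mlead_power l x a b : a != b -> mlead l x -> mlead l (x ^+ a * x^-1 ^+ b)%g.
Proof.
move=> neq [Hx cx]; have HVx := mlowV Hx; split.
  by apply: mlowM; apply: mlowX.
rewrite mcoefM ?mcoefX ?mcoefV //; last exact: mlowX.
move: (mcoef l x) cx => c c0.
rewrite -[c *+ _]mulr_natr -[(- c) *+ _]mulr_natr !natz => E.
have /eqP : c * (a%:Z - b%:Z) = 0 by rewrite mulrBr -mulNr.
by rewrite mulf_eq0 subr_eq0 eqz_nat (negbTE neq) orbF => /eqP.
Qed.

(* The list [W] only makes the recursion well founded: the leading word of the
   eliminated element is no longer a monomial of the new system. *)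
Lemma elimination E (W : seq (seq 'I_n)) :
    good_system E ->
    (forall w, monomial (words E) w -> (size w <= k)%N -> w \in W) ->
  forall g, span E g ->
    gamma k.+1 g \/ exists l, [/\ monomial (words E) l, (size l <= k)%N & mlead l g].
Proof.
have [N] := ubnP (size W); elim: N W E => // N IH W E leW goodE EW g Hg.
have [leadE funE codeE] := goodE.
have wordsW l : words E l -> l \in W.
  move=> Ll; apply: EW; first exact: monomial1.
  by case: Ll => h /leadE[].
have [[l0 Ll0]|E0] := pselect (exists l, words E l); last first.
  left; move: Hg; apply: generated_min; first exact: gamma_subgroup.
  by move=> h [[l Eh]|//]; case: E0; exists l, h.
have [||||lx [[x Ex] minx]] := @prec_min n (words E) W.
- by move=> u; apply: code_neq0.
- by move=> u v; apply: code_comm.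
- exact: wordsW.
- by exists l0.
have Lx : words E lx by exists x.
have [sx gx mx] := leadE _ _ Ex.
have [a [b [z [-> Hz]]]] := span_elim goodE Ex Hg.
have goodE' := good_elim_system goodE Ex minx.
set E' := elim_system x lx E in goodE' Hz.
have monE' l : monomial (words E') l -> monomial (elim_words lx (words E)) l.
  exact: monomial_elim_system.
(* The list shrinks because [lx] is in [W]; it still contains the monomials of [E'] of length at
   most [k], which are monomials of [E] other than [lx]. *)
have [||IHz|IHz] := IH (filter (predC1 lx) W) E' _ goodE' _ z Hz.
- rewrite size_filter -ltnS; apply: leq_trans leW; rewrite ltnS.
  rewrite -(count_predC (pred1 lx)) -[X in (X < _)%N]add0n ltn_add2r.
  by rewrite -has_count has_pred1 wordsW.
- move=> l Hl sl; rewrite mem_filter EW //; last first.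
    by apply: monomial_elim Lx _; apply: monE'.
  rewrite andbT /=; apply/eqP => El; rewrite El in Hl.
  exact: (monomial_elim_neq Lx codeE (monE' _ Hl)).
- have [->|neq] := eqVneq a b.
    by rewrite expVgn mulgV mul1g; left.
  right; exists lx; split=> //; first exact: monomial1.
  by apply: mleadMl; [apply: mlead_power | apply: gamma_mlow IHz].
case: IHz => l [Ml sl ml]; right.
have Ml' := monomial_elim Lx (monE' _ Ml).
have [->|neq] := eqVneq a b.
  by exists l; split=> //; rewrite expVgn mulgV mul1g.
have [xlow _] := mx; have powlow : mlow lx (x ^+ a * x^-1 ^+ b)%g.
  by apply: mlowM; apply: mlowX => //; apply: mlowV.
(* The smaller of the two leading words survives in the product. They cannot coincide, since [lx] is
   no monomial of [E']. *)
have [lt|lt|/key_inj E1] := ltngtP (key lx) (key l).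
- exists lx; split=> //; first exact: monomial1.
  by apply: mleadMl; [apply: mlead_power | apply: mlow_lt lt _; case: ml].
- by exists l; split=> //; apply: mleadMr ml; apply: mlow_lt lt _.
by case: (monomial_elim_neq Lx codeE); apply: monE'; rewrite E1.
Qed.

(** The elimination starts from the free generators with their one-letter words. Its second outcome,
    a leading word of length at most [k], contradicts the order of [magnus g - 1]. *)
Theorem magnus_ord_gamma g : ord_ge k.+1 (magnus g - 1) -> gamma k.+1 g.
Proof.
move=> Hg; pose E (h : FG n) l := exists i, h = FGgen n i /\ l = [:: i].
have [k0|kpos] := posnP k; first by rewrite k0.
have goodE : good_system E.
  split=> [_ _ [i [-> ->]]|h h' _ [i [-> ->]] [j [-> [->]]] //|a b].
    by split=> //; apply: mlead_gen.
  elim: a b => [|u a IH] [|v b] //= Ha Hb.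
  - by have [h [i [_ ->]]] := Hb v (mem_head _ _).
  - by have [h [i [_ ->]]] := Ha u (mem_head _ _).
  have [h [i [_ Eu]]] := Ha u (mem_head _ _).
  have [h' [j [_ Ev]]] := Hb v (mem_head _ _).
  rewrite Eu Ev => -[-> /IH ->] // w Hw; [apply: Ha|apply: Hb];
    by rewrite inE Hw orbT.
have spanE h : span E h.
  have [H1 HM HV] := generated_subgroup (fun g => (exists l, E g l) \/ gamma k.+1 g).
  elim/FG_ind: h => [//|i h IH|i h IH]; apply: HM => //; try apply: HV;
    by apply: gen_base; left; exists [:: i], i.
pose W := flatten [seq [seq val t | t <- enum {: m.-tuple 'I_n}] | m <- iota 0 k.+1].
have EW w : monomial (words E) w -> (size w <= k)%N -> w \in W.
  move=> _ sw; apply/flattenP; exists [seq val t | t <- enum {: (size w).-tuple 'I_n}].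
    by apply/mapP; exists (size w); rewrite // mem_iota add0n ltnS sw.
  by apply/mapP; exists (in_tuple w); rewrite // mem_enum.
have [//|[l [_ sl [_]]]] := elimination goodE EW (spanE g).
by rewrite /mcoef Hg.
Qed.

End Elimination.

(** * The Andreadakis filtration *)

Section AndreadakisFiltration.
Variable n : nat.
Implicit Types (x y g : FG n) (f h : End_ n).

(** By [mcongrP] this is congruence modulo [gamma k]; in this form, compatibility with products and
    inverses is a computation in a ring. *)
Definition mcongr k x y := ord_ge k (magnus y - magnus x).

Lemma mcongrP k x y : mcongr k x y <-> gamma k (x^-1 * y)%g.
Proof.
have E : magnus y - magnus x = magnus x * (magnus (x^-1 * y)%g - 1).
  by rewrite mulrBr mulr1 -magnusM mulVKg.
split=> [Hxy|/gamma_magnus_ord Hxy]; last by rewrite /mcongr E; apply: ord_geMl.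
case: k Hxy => // k Hxy; apply: magnus_ord_gamma.
have -> : magnus (x^-1 * y)%g - 1 = magnus x^-1%g * (magnus y - magnus x).
  by rewrite mulrBr -!magnusM mulVg.
exact: ord_geMl.
Qed.

Lemma mcongr_refl k x : mcongr k x x.
Proof. by rewrite /mcongr subrr; apply: ord_ge0. Qed.

Lemma mcongr_sym k x y : mcongr k x y -> mcongr k y x.
Proof. by move=> /ord_geN; rewrite opprB. Qed.

Lemma mcongr_trans k x y z : mcongr k x y -> mcongr k y z -> mcongr k x z.
Proof. by move=> Hxy Hyz; have := ord_geD Hyz Hxy; rewrite addrA subrK. Qed.

Lemma mcongrM k x x' y y' :
  mcongr k x y -> mcongr k x' y' -> mcongr k (x * x')%g (y * y')%g.
Proof.
move=> Hx Hy; rewrite /mcongr !magnusM.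
have -> : magnus y * magnus y' - magnus x * magnus x' =
  (magnus y - magnus x) * magnus y' + magnus x * (magnus y' - magnus x').
  by rewrite mulrBl mulrBr addrA subrK.
by apply: ord_geD; [apply: ord_geMr | apply: ord_geMl].
Qed.

Lemma mcongrV k x y : mcongr k x y -> mcongr k x^-1%g y^-1%g.
Proof.
move=> Hxy; rewrite /mcongr.
have -> : magnus y^-1%g - magnus x^-1%g =
  magnus y^-1%g * (- (magnus y - magnus x)) * magnus x^-1%g.
  by rewrite opprB mulrBr mulrBl -!magnusM mulVg mul1g -mulgA mulgV mulg1.
exact/ord_geMr/ord_geMl/ord_geN.
Qed.

Lemma mcongr_eval k f x y :
  mcongr k x y -> mcongr k (evalE n f x) (evalE n f y).
Proof.
move=> /mcongrP/(@gamma_evalE _ _ f) H; apply/mcongrP.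
by rewrite -evalEV -evalEM.
Qed.

Definition acts_trivially k f := forall g, mcongr k.+1 g (evalE n f g).

Lemma Andreadakis_acts k f : Andreadakis n k f <-> isAut n f /\ acts_trivially k f.
Proof.
by split=> -[autf Hf]; split=> // g; apply/mcongrP; apply: Hf.
Qed.

(** On a commutator, [magnus_comm] and bilinearity express the change as a sum of products, each
    containing the change of one factor, and orders add up. *)
Lemma acts_gamma k j f g :
  acts_trivially k f -> gamma j.+1 g -> mcongr (j + k).+1 g (evalE n f g).
Proof.
move=> Hf; elim: j g => [|j IH] g; first by move=> _; apply: Hf.
rewrite gammaSS.
apply: (generated_min (H := fun g => mcongr (j.+1 + k).+1 g (evalE n f g))).
  split=> [|x y Hx Hy|x Hx]; rewrite ?evalEM ?evalEV.
  - exact: mcongr_refl.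
  - exact: mcongrM.
  - exact: mcongrV.
move=> _ [a [b [_ [_ [Ha _ -> -> ->]]]]].
rewrite -!mulgA -[(_ * (_ * _))%g]/[~ a, b]%g /mcongr.
have -> : evalE n f [~ a, b]%g = [~ evalE n f a, evalE n f b]%g.
  by rewrite /commg /conjg !evalEM !evalEV.
set a' := evalE n f a; set b' := evalE n f b.
have Hka : ord_ge (j + k).+1 (magnus a' - magnus a) by apply: IH.
have Hkb : ord_ge k.+1 (magnus b' - magnus b) by apply: Hf.
have Ha1 : ord_ge j.+1 (magnus a - 1) by apply: gamma_magnus_ord.
have Ha'1 : ord_ge j.+1 (magnus a' - 1) by apply/gamma_magnus_ord/gamma_evalE.
have subD (R : pzRingType) (p q r s : R) : p * q - r * s = (p - r) * q + r * (q - s).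
  by rewrite mulrBl mulrBr addrA subrK.
have sub1 (R : pzRingType) (p q : R) : p - q = (p - 1) - (q - 1).
  by rewrite opprB addrA subrK.
have HC : ord_ge (j + 2) (magnus a' * magnus b' - magnus b' * magnus a').
  rewrite comm_sub1; apply: ord_geB.
    by rewrite addn2 -addn1; apply: ord_geM; [|apply: magnus_ord1].
  by rewrite addn2 -add1n; apply: ord_geM; [apply: magnus_ord1|].
(* One summand is a difference of unit factors times a bracket, the other a unit factor times a
   difference of brackets. *)
rewrite sub1 !magnus_comm subD; apply: ord_geD.
  have -> : (j.+1 + k).+1 = (k + (j + 2))%N by lia.
  apply: ord_geM HC; apply: (@ord_ge_le _ _ k.+1) => //.
  by apply/mcongrV/mcongrM; apply: Hf.
have Haa' : ord_ge (j + k).+1 ((magnus a' - 1) - (magnus a - 1)) by rewrite -sub1.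
have Hbb' : ord_ge k.+1 ((magnus b' - 1) - (magnus b - 1)) by rewrite -sub1.
have Hb1 := magnus_ord1 b; have Hb'1 := magnus_ord1 b'.
apply: ord_geMl; rewrite (comm_sub1 (magnus a')) (comm_sub1 (magnus a)).
move: (magnus a' - 1) (magnus a - 1) (magnus b' - 1) (magnus b - 1)
  Ha1 Ha'1 Haa' Hbb' Hb1 Hb'1 => A' A B' B Ha1 Ha'1 Haa' Hbb' Hb1 Hb'1.
have -> : A' * B' - B' * A' - (A * B - B * A) =
    (A' * B' - A * B) - (B' * A' - B * A).
  by rewrite !opprD !opprK addrACA.
have E1 : (j.+1 + k).+1 = ((j + k).+1 + 1)%N by lia.
have E2 : (j.+1 + k).+1 = (j.+1 + k.+1)%N by lia.
have E3 : (j.+1 + k).+1 = (k.+1 + j.+1)%N by lia.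
have E4 : (j.+1 + k).+1 = (1 + (j + k).+1)%N by lia.
apply: ord_geB; rewrite subD; apply: ord_geD.
- by rewrite E1; apply: ord_geM.
- by rewrite E2; apply: ord_geM.
- by rewrite E3; apply: ord_geM.
by rewrite E4; apply: ord_geM.
Qed.

Lemma acts_comp k f h :
  acts_trivially k f -> acts_trivially k h -> acts_trivially k (compE n f h).
Proof.
move=> Hf Hh g; rewrite evalE_comp; exact: mcongr_trans (Hh g) (Hf _).
Qed.

Lemma acts_inv k f f' : isinvE n f f' -> acts_trivially k f -> acts_trivially k f'.
Proof.
move=> ff' Hf g; have := mcongr_sym (mcongr_eval f' (Hf g)).
by rewrite (isinvE_can ff').
Qed.

Lemma acts_id k : acts_trivially k (idE n).
Proof. by move=> g; rewrite evalE_id; apply: mcongr_refl. Qed.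

(** It suffices that [f] and [h] commute up to congruence. With [f g = g * a] and [h g = g * b], the
    two composites at [g] are congruent to [g * a * b] and [g * b * a] by [acts_gamma], and [a], [b]
    commute to sufficient order. *)
Lemma acts_commutator k f f' h h' :
    isinvE n f f' -> isinvE n h h' ->
    acts_trivially k.+1 f -> acts_trivially 1 h ->
  acts_trivially k.+2 (compE n (compE n (compE n f' h') f) h).
Proof.
move=> ff' hh' Hf Hh g; rewrite !evalE_comp.
set fhg := evalE n f (evalE n h g).
suff : mcongr k.+3 (evalE n h (evalE n f g)) fhg.
  move/(mcongr_eval h')/(mcongr_eval f').
  by rewrite (isinvE_can hh') (isinvE_can ff').
have /mcongrP Ga := Hf g; have /mcongrP Gb := Hh g.
set a := (g^-1 * evalE n f g)%g in Ga; set b := (g^-1 * evalE n h g)%g in Gb.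
have fg : evalE n f g = (g * a)%g by rewrite mulVKg.
have hg : evalE n h g = (g * b)%g by rewrite mulVKg.
clearbody a b.
have -> : fhg = (g * a * evalE n f b)%g by rewrite /fhg hg evalEM fg.
have -> : evalE n h (evalE n f g) = (g * b * evalE n h a)%g by rewrite fg evalEM hg.
have Hb : mcongr k.+3 b (evalE n f b) := acts_gamma Hf Gb.
have Ha : mcongr k.+3 a (evalE n h a).
  by have := acts_gamma Hh Ga; rewrite addn1.
apply: mcongr_trans (mcongrM (mcongr_refl (g * b)%g) (mcongr_sym Ha)) _.
apply: mcongr_trans (mcongrM (mcongr_refl (g * a)%g) Hb).
rewrite -!mulgA; apply: mcongrM; first exact: mcongr_refl.
rewrite /mcongr !magnusM comm_sub1; apply: ord_geB.
  apply: (@ord_ge_le _ _ (k.+2 + 2)); first by lia.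
  by apply: ord_geM; apply: gamma_magnus_ord.
apply: (@ord_ge_le _ _ (2 + k.+2)); first by lia.
by apply: ord_geM; apply: gamma_magnus_ord.
Qed.

End AndreadakisFiltration.

(** * Partial inner automorphisms *)

Section PartialConjugations.
Variable n : nat.
Implicit Types (u v w x y g : FG n) (f h : End_ n) (i : 'I_n) (p q : nat).

(** Retraction onto the free subgroup on the first [p] generators, which is the set of its fixed
    points. *)
Definition retr p : End_ n := [ffun i : 'I_n => if (i < p)%N then FGgen n i else 1%g].

(* [supp p w]: only the generators [x_i] with [i < p] occur in [w]. *)
Definition supp p w := evalE n (retr p) w = w.

(** With [w] on the left, [conj_aut p] is multiplicative on elements supported on the first [p]
    generators; [nu n p i] then corresponds to an inverse generator. *)
Definition conj_aut p w : End_ n :=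
  [ffun i : 'I_n => if (i < p)%N then (w * FGgen n i * w^-1)%g else FGgen n i].

Lemma supp1 p : supp p 1%g. Proof. exact: evalE1. Qed.

Lemma suppM p u v : supp p u -> supp p v -> supp p (u * v)%g.
Proof. by rewrite /supp evalEM => -> ->. Qed.

Lemma suppV p u : supp p u -> supp p u^-1%g.
Proof. by rewrite /supp evalEV => ->. Qed.

Lemma supp_gen p i : (i < p)%N -> supp p (FGgen n i).
Proof. by move=> ltip; rewrite /supp evalE_gen ffunE ltip. Qed.

(** A supported element is its own image under [retr p], in which only the letters below [p]
    survive. *)
Lemma supp_ind p (P : FG n -> Prop) :
    P 1%g ->
    (forall i x, (i < p)%N -> supp p x -> P x -> P (FGgen n i * x)%g) ->
    (forall i x, (i < p)%N -> supp p x -> P x -> P ((FGgen n i)^-1 * x)%g) ->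
  forall x, supp p x -> P x.
Proof.
move=> P1 PM PV x <-.
suff : supp p (evalE n (retr p) x) /\ P (evalE n (retr p) x) by case.
elim/FG_ind: x => [|i x [sx Px]|i x [sx Px]].
- by rewrite evalE1; split=> //; apply: supp1.
- rewrite (evalEM (retr p)) evalE_gen ffunE; case: ifP => ltip; last by rewrite mul1g.
  by split; [apply: suppM => //; apply: supp_gen | apply: PM].
rewrite (evalEM (retr p)) evalEV evalE_gen ffunE.
case: ifP => ltip; last by rewrite invg1 mul1g.
by split; [apply: suppM => //; apply/suppV/supp_gen | apply: PV].
Qed.

Lemma supp_le p q w : (p <= q)%N -> supp p w -> supp q w.
Proof.
move=> le_pq; elim/supp_ind => [|i x ltip _ IH|i x ltip _ IH]; first exact: supp1.
  by apply: suppM => //; apply/supp_gen/(leq_trans ltip).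
by apply: suppM => //; apply/suppV/supp_gen/(leq_trans ltip).
Qed.

Lemma supp_eval p f w :
  (forall i, (i < p)%N -> supp p (f i)) -> supp p w -> supp p (evalE n f w).
Proof.
move=> Hf; elim/supp_ind => [|i x ltip _ IH|i x ltip _ IH]; first exact: supp1.
  by rewrite evalEM evalE_gen; apply: suppM => //; apply: Hf.
by rewrite evalEM evalEV evalE_gen; apply: suppM => //; apply/suppV/Hf.
Qed.

Lemma conj_aut_supp p u v :
  supp p v -> evalE n (conj_aut p u) v = (u * v * u^-1)%g.
Proof.
elim/supp_ind => [|i x ltip _ IH|i x ltip _ IH].
- by rewrite evalE1 mulg1 mulgV.
- by rewrite evalEM IH evalE_gen ffunE ltip !mulgA mulgVK.
rewrite evalEM IH evalEV evalE_gen ffunE ltip !invgM invgK.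
by rewrite !mulgA mulgVK.
Qed.

Lemma conj_aut_comp p u v :
  supp p v -> compE n (conj_aut p u) (conj_aut p v) = conj_aut p (u * v)%g.
Proof.
move=> sv; apply/ffunP => i; rewrite [LHS]ffunE [conj_aut p v i]ffunE.
rewrite [RHS]ffunE; case: ifP => ltip; last by rewrite evalE_gen ffunE ltip.
rewrite conj_aut_supp; last by apply: suppM (suppV sv); apply: suppM (supp_gen _).
by rewrite invgM !mulgA.
Qed.

Lemma conj_aut1 p : conj_aut p 1%g = idE n.
Proof. by apply/ffunP => i; rewrite !ffunE mul1g invg1 mulg1; case: ifP. Qed.

Lemma conj_aut_inv p u : supp p u -> isinvE n (conj_aut p u) (conj_aut p u^-1%g).
Proof.
move=> su; split; rewrite conj_aut_comp ?mulgV ?mulVg ?conj_aut1 //.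
exact: suppV.
Qed.

Lemma nuE p i : nu n p i = conj_aut p (FGgen n i)^-1%g.
Proof.
by apply/ffunP => j; rewrite !ffunE !FGmulE FGinvE invgK mulgA.
Qed.

Lemma conj_aut_PartialInner p w :
  (2 <= p <= n)%N -> supp p w -> PartialInner n (conj_aut p w).
Proof.
move=> /andP[le2p lepn].
have PV i : (i < p)%N -> PartialInner n (conj_aut p (FGgen n i)^-1%g).
  by move=> ltip; rewrite -nuE; apply: gen_base; exists p, i.
elim/supp_ind => [|i x ltip sx IH|i x ltip sx IH].
- by rewrite conj_aut1; apply: gen_one.
- rewrite -conj_aut_comp //; apply: gen_mul IH; apply: gen_inv (PV i ltip) _.
  by rewrite -[X in isinvE n _ (conj_aut p X)]invgK; apply/conj_aut_inv/suppV/supp_gen.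
by rewrite -conj_aut_comp //; apply: gen_mul IH; apply: PV.
Qed.

Lemma supp_retr p g : supp p (evalE n (retr p) g).
Proof.
elim/FG_ind: g => [|i x IH|i x IH].
- by rewrite evalE1; apply: supp1.
- rewrite evalEM evalE_gen ffunE; apply: suppM => //.
  by case: ifP => [|_]; [apply: supp_gen | apply: supp1].
rewrite evalEM evalEV evalE_gen ffunE; apply: suppM => //; apply: suppV.
by case: ifP => [|_]; [apply: supp_gen | apply: supp1].
Qed.

(** Precomposing with the retraction gives a homomorphism from all of [FG n] to the partial inner
    group, and homomorphisms respect lower central series. No comparison with the series of the
    subgroup on [p] generators arises. *)
Lemma conj_aut_gamma p k g :
    (2 <= p <= n)%N -> gamma k g ->
  GammaAut n (PartialInner n) k (conj_aut p (evalE n (retr p) g)).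
Proof.
move=> hp; have sr x := supp_retr p x.
pose c x := conj_aut p (evalE n (retr p) x).
have cPI x : PartialInner n (c x) by apply: conj_aut_PartialInner.
have cM x y : c (x * y)%g = compE n (c x) (c y).
  by rewrite /c evalEM conj_aut_comp.
have cV x : isinvE n (c x) (c x^-1%g) by rewrite /c evalEV; apply: conj_aut_inv.
rewrite -/(c g); elim: k g => [|[|k] IH] g; try by move=> _; apply: cPI.
rewrite gammaSS.
apply: (generated_min (H := fun g => GammaAut n (PartialInner n) k.+2 (c g))).
  split=> [|x y Hx Hy|x Hx].
  - by rewrite /c evalE1 conj_aut1; apply: gen_one.
  - by rewrite cM; apply: gen_mul.
  - by apply: gen_inv Hx (cV x).
move=> _ [a [b [_ [_ [Ha _ -> -> ->]]]]]; rewrite !cM; apply: gen_base.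
by exists (c a), (c b), (c a^-1%g), (c b^-1%g); split=> //; apply: IH.
Qed.

(** The rule [gen_inv] presupposes an inverse; its existence is traced back to the generators. *)
Lemma PartialInner_inv f :
  PartialInner n f -> exists2 f', isinvE n f f' & PartialInner n f'.
Proof.
elim=> {f} [|f [p [i [le2p lepn ltip ->]]]|f h _ [f' ff' Hf'] _ [h' hh' Hh']|
  f h Hf _ fh].
- by exists (idE n); [apply: isinvE_id | apply: gen_one].
- have sV := suppV (supp_gen ltip); rewrite nuE.
  exists (conj_aut p (FGgen n i)^-1^-1%g); first exact: conj_aut_inv.
  by apply: conj_aut_PartialInner; [rewrite le2p | apply: suppV].
- by exists (compE n h' f'); [apply: isinvE_comp | apply: gen_mul].
by exists f => //; apply: isinvE_sym.
Qed.

Lemma nu_acts p i : (i < p)%N -> acts_trivially 1 (nu n p i).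
Proof.
move=> ltip g; elim/FG_ind: g => [|j x IH|j x IH].
- by rewrite evalE1; apply: mcongr_refl.
- rewrite evalEM; apply: mcongrM IH; rewrite evalE_gen nuE ffunE.
  case: ifP => _; last exact: mcongr_refl.
  apply/mcongrP; set y := (FGgen n i)^-1%g; set z := FGgen n j.
  have -> : (z^-1 * (y * z * y^-1) = [~ z, y^-1])%g.
    by rewrite /commg /conjg invgK !mulgA.
  exact: (@gamma_comm1 _ 0).
rewrite evalEM evalEV; apply: mcongrM IH; apply: mcongrV; rewrite evalE_gen nuE ffunE.
case: ifP => _; last exact: mcongr_refl.
apply/mcongrP; set y := (FGgen n i)^-1%g; set z := FGgen n j.
have -> : (z^-1 * (y * z * y^-1) = [~ z, y^-1])%g.
  by rewrite /commg /conjg invgK !mulgA.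
exact: (@gamma_comm1 _ 0).
Qed.

Lemma PartialInner_acts f : PartialInner n f -> acts_trivially 1 f.
Proof.
elim=> {f} [|f [p [i [_ _ ltip ->]]]|f h _ Hf _ Hh|f h _ Hf fh].
- exact: acts_id.
- exact: nu_acts.
- exact: acts_comp.
exact: acts_inv fh Hf.
Qed.

(** The inclusion that follows from the Andreadakis filtration being central. *)
Lemma GammaAut_acts k f :
  GammaAut n (PartialInner n) k.+1 f -> PartialInner n f /\ acts_trivially k.+1 f.
Proof.
elim: k f => [|k IH] f; first by move=> Hf; split=> //; apply: PartialInner_acts.
elim=> {f} [|_ [f [h [f' [h' [Hf Hh ff' hh' ->]]]]]|f h _ [Hf Af] _ [Hh Ah]|
  f h _ [Hf Af] fh].
- by split; [apply: gen_one | apply: acts_id].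
- have [Pf Af] := IH _ Hf; split.
    have Pf' : PartialInner n f' by apply: gen_inv ff'.
    have Ph' : PartialInner n h' by apply: gen_inv hh'.
    by do 3?[apply: gen_mul => //].
  by apply: acts_commutator => //; apply: PartialInner_acts.
- by split; [apply: gen_mul | apply: acts_comp].
by split; [apply: gen_inv Hf fh | apply: acts_inv fh Af].
Qed.

End PartialConjugations.

(** * Triangular normal form of partial inner automorphisms *)

Section Decomposition.
Variable n : nat.
Implicit Types (u v w x y g : FG n) (f h : End_ n) (i : 'I_n) (p q : nat).

(* Conjugating [x_1] by a power of itself is trivial, so the factors start at
   [p = 2]. *)
Fixpoint triangular p f : Prop :=
  match p with
  | 0 => f = idE n
  | p'.+1 => if p' is 0 then f = idE n else
      exists w h, [/\ supp p w, triangular p' h & f = compE n (conj_aut p w) h]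
  end.

Lemma triangularSS p f : triangular p.+2 f =
  exists w h, [/\ supp p.+2 w, triangular p.+1 h & f = compE n (conj_aut p.+2 w) h].
Proof. by []. Qed.

Lemma triangular_id p : triangular p (idE n).
Proof.
elim: p => [|[|p] IH] //; exists 1%g, (idE n).
by rewrite conj_aut1 comp1E; split=> //; apply: supp1.
Qed.

Lemma triangular_leq p q f : (0 < p <= q)%N -> triangular p f -> triangular q f.
Proof.
move=> /andP[p0 /subnK <-]; elim: (q - p)%N => // m IH Hf; rewrite addSn.
case Em : (m + p)%N => [|l]; first by lia.
rewrite -Em; rewrite Em in IH *; exists 1%g, f.
by rewrite conj_aut1 comp1E; split=> //; apply: IH.
Qed.

Lemma triangular_fix p f i : triangular p f -> (p <= i)%N -> f i = FGgen n i.
Proof.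
elim: p f => [|[|p] IH] f; try by move=> -> _; rewrite ffunE.
rewrite triangularSS => -[w [h [_ Hh ->]]] ltpi; rewrite ffunE (IH h) ?(ltnW ltpi) //.
by rewrite evalE_gen ffunE ltnNge ltpi.
Qed.

Lemma triangular_supp p q f w :
  triangular p f -> (p <= q)%N -> supp q w -> supp q (evalE n f w).
Proof.
elim: p f w => [|[|p] IH] f w; try by move=> -> _; rewrite evalE_id.
rewrite triangularSS => -[v [h [sv Hh ->]]] ltpq sw; rewrite evalE_comp.
apply: supp_eval => [i ltiq|]; last by apply: (IH h) => //; apply: ltnW.
have svq := supp_le ltpq sv; rewrite ffunE.
case: ifP => _; last exact: supp_gen.
by apply: suppM (suppV svq); apply: suppM (supp_gen _).
Qed.

(** Here [f] preserves the subgroup on the first [p.+1] generators and fixes all generators from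
    index [p] on, so moving the conjugation past [f] only changes its word. Closure of the normal
    form under products and inverses rests on this. *)
Lemma triangular_conj p f w :
    triangular p f -> supp p.+1 w ->
  compE n f (conj_aut p.+1 w) = compE n (conj_aut p.+1 (evalE n f w)) f.
Proof.
move=> Hf sw; apply/ffunP => i; rewrite [LHS]ffunE [RHS]ffunE [conj_aut _ w i]ffunE.
case: ifP => ltip.
  rewrite !evalEM evalEV evalE_gen conj_aut_supp // -[f i]evalE_gen.
  by apply: triangular_supp Hf _ _; [apply: leqnSn | apply: supp_gen].
rewrite evalE_gen (triangular_fix Hf) ?evalE_gen ?ffunE ?ltip //.
by rewrite ltnW // ltnNge -ltnS ltip.
Qed.

Lemma triangular_comp p f h :
  triangular p f -> triangular p h -> triangular p (compE n f h).
Proof.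
elim: p f h => [|[|p] IH] f h; try by move=> -> ->; apply: comp1E.
rewrite !triangularSS => -[u [f1 [su Hf1 ->]]] [v [h1 [sv Hh1 ->]]].
have sfv : supp p.+2 (evalE n f1 v) by exact: (triangular_supp Hf1 (leqnSn _) sv).
exists (u * evalE n f1 v)%g, (compE n f1 h1); split; last 1 first.
- rewrite -conj_aut_comp // -!compEA; congr compE.
  by rewrite !compEA triangular_conj.
- exact: suppM.
exact: IH.
Qed.

Lemma triangular_inv p f :
  triangular p f -> exists2 f', isinvE n f f' & triangular p f'.
Proof.
elim: p f => [|[|p] IH] f; try by move=> ->; exists (idE n); first exact: isinvE_id.
rewrite triangularSS => -[u [f1 [su Hf1 ->]]]; have [h f1h Hh] := IH _ Hf1.
exists (compE n h (conj_aut p.+2 u^-1%g)).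
  exact: isinvE_comp (conj_aut_inv su) f1h.
rewrite triangular_conj //; last exact: suppV.
exists (evalE n h u^-1%g), h; split=> //.
exact: (triangular_supp Hh (leqnSn _) (suppV su)).
Qed.

Lemma PartialInner_triangular f : PartialInner n f -> triangular n f.
Proof.
elim=> {f} [|f [p [i [le2p lepn ltip ->]]]|f h _ Hf _ Hh|f h _ Hf fh].
- exact: triangular_id.
- apply: (@triangular_leq p); first by rewrite lepn (ltnW le2p).
  case: p le2p {lepn} ltip => [|[|p]] // _ ltip.
  exists (FGgen n i)^-1%g, (idE n); split; [|exact: triangular_id|].
    exact/suppV/supp_gen.
  by rewrite compE1 nuE.
- exact: triangular_comp.
by have [f' ff' Hf'] := triangular_inv Hf; rewrite (isinvE_uniq fh ff').
Qed.

End Decomposition.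

(** * Magnus coefficients and centralizers of generators *)

Section MagnusCoefficients.
Variable n : nat.
Implicit Types (u v : seq 'I_n) (f g h : ncseries 'I_n) (x w : FG n) (q i : 'I_n).

Lemma magnus_gen_inv i : magnus (FGgen n i)^-1%g = magnus_letter (i, true).
Proof. by rewrite -[_^-1%g](FG_of_letter (i, true)) magnus_of /= mulr1. Qed.

Lemma magnus_supp p w a u :
  supp p w -> a \in u -> (p <= nat_of_ord a)%N -> magnus w u = 0.
Proof.
move=> sw + lepa; elim/supp_ind: sw u => [|i x ltip _ IH|i x ltip _ IH] u au.
- by rewrite magnus1 nc1E; case: u au.
- rewrite magnusM; apply: ncM_eq0 => u1 u2 E; move: au; rewrite E mem_cat.
  case/orP=> [au|/IH ->]; last exact: mulr0.
  rewrite magnus_gen; case: u1 au {E} => [|b [|c u1]] //= au; last first.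
    by rewrite eqseq_cons andbF mul0r.
  rewrite eqseq_cons andbT; move: au; rewrite inE => /eqP <-.
  by case: eqP => [Ea|_]; [move: ltip; rewrite -Ea ltnNge lepa | rewrite mul0r].
rewrite magnusM; apply: ncM_eq0 => u1 u2 E; move: au; rewrite E mem_cat.
case/orP=> [au|/IH ->]; last exact: mulr0.
rewrite magnus_gen_inv /magnus_letter /=.
case: allP => [/(_ _ au)/eqP Ea|]; last by rewrite mul0r.
by move: ltip; rewrite -Ea ltnNge lepa.
Qed.

(** Equality after setting all variables but [X_q] to zero, a ring map, whence the compatibility
    with products. *)
Definition agree_on_powers q f g := forall d, f (nseq d q) = g (nseq d q).

Lemma agree_on_powersM q f f' g g' :
  agree_on_powers q f f' -> agree_on_powers q g g' ->
  agree_on_powers q (f * g) (f' * g').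
Proof.
move=> Hf Hg d; rewrite -[LHS]/(nc_mul f g _) -[RHS]/(nc_mul f' g' _).
apply: eq_bigr => -[i /= ltid] _; have leid : (i <= d)%N by rewrite size_nseq in ltid.
by rewrite take_nseq // drop_nseq Hf Hg.
Qed.

(* Killing the generators other than [x_q] leaves a power of [x_q]. *)
Lemma magnus_powers q w :
  exists a b, agree_on_powers q (magnus w)
    (magnus (FGgen n q ^+ a * (FGgen n q)^-1 ^+ b)%g).
Proof.
elim/FG_ind: w => [|i x [a [b IH]]|i x [a [b IH]]].
- by exists 0%N, 0%N; rewrite mulg1.
- have [->|neq] := eqVneq i q.
    exists a.+1, b => d; rewrite expgS -mulgA [in LHS]magnusM [in RHS]magnusM.
    exact: agree_on_powersM.
  exists a, b => d; rewrite magnusM -[in RHS](mul1r (magnus _)).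
  apply: agree_on_powersM => // -[|e]; rewrite magnus_gen nc1E //=.
  by rewrite eqseq_cons [q == i]eq_sym (negbTE neq).
have [->|neq] := eqVneq i q.
  exists a, b.+1 => d; rewrite expgS.
  have -> : (FGgen n q ^+ a * ((FGgen n q)^-1 * (FGgen n q)^-1 ^+ b) =
             (FGgen n q)^-1 * (FGgen n q ^+ a * (FGgen n q)^-1 ^+ b))%g.
    rewrite !mulgA; congr (_ * _)%g; apply/commute_sym/commuteX/commute_sym.
    exact/commuteV/commute_refl.
  by rewrite [in LHS]magnusM [in RHS]magnusM; apply: agree_on_powersM.
exists a, b => d; rewrite magnusM -[in RHS](mul1r (magnus _)).
apply: agree_on_powersM => // e; rewrite magnus_gen_inv nc1E /magnus_letter /=.
by case: e => //= e; rewrite eq_sym (negbTE neq).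
Qed.

(** The image of [w] is a power of [x_q], and a nontrivial power would have leading word
    [[:: q]]. *)
Lemma magnus_power0 q w d : magnus w [:: q] = 0 -> magnus w (nseq d.+1 q) = 0.
Proof.
have [a [b E]] := magnus_powers q w.
have [Eab _|neq] := eqVneq a b.
  by rewrite E Eab expVgn mulgV magnus1 nc1E.
have [_] := mlead_power neq (mlead_gen q).
by rewrite /mcoef ncB -(E 1%N) nc1E subr0.
Qed.

Lemma magnus_mul_gen_cons q i w u :
  magnus (FGgen n q * w)%g (i :: u) = magnus w (i :: u) + (i == q)%:R * magnus w u.
Proof.
rewrite magnusM ncM_cons magnus_nil mul1r; congr (_ + _).
rewrite -[u in LHS]cat0s ncM_single; last first.
  move=> [|b u1] u2 _ // _; rewrite /nc_shift magnus_gen /= eqseq_cons andbF.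
  exact: mul0r.
by rewrite /nc_shift magnus_gen /= eqseq_cons andbT.
Qed.

Lemma magnus_mul_gen_rcons q w u :
  magnus (w * FGgen n q)%g (rcons u q) = magnus w (rcons u q) + magnus w u.
Proof.
have -> : magnus (w * FGgen n q)%g =
    magnus w + magnus w * (magnus (FGgen n q) - 1).
  by rewrite mulrBr mulr1 addrC subrK magnusM.
rewrite ncD -cats1; congr (_ + _); rewrite ncM_single.
  by rewrite ncB magnus_gen nc1E /= eqxx subr0 mulr1.
move=> u1 u2 E ne; rewrite ncB magnus_gen nc1E.
case: u2 E => [|a [|b u2]] E /=; first by rewrite subrr mulr0.
  by case: ne; move: E; rewrite !cats1 => /rcons_inj[].
by rewrite eqseq_cons andbF subr0 mulr0.
Qed.

(* Comparing coefficients in [x_q w] and [w x_q] moves a leading [x_q] of a word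
   to its end, until some other letter comes first or only [x_q] occurs. *)
Lemma gamma_centralizer q w k :
    magnus w [:: q] = 0 ->
    mcongr k.+1 (FGgen n q * w)%g (w * FGgen n q)%g ->
  gamma k w.
Proof.
move=> w0 comm.
(* The coefficient at [i :: u] is read off from the congruence at the longer word
   [rcons (i :: u) q]; this costs one degree. *)
have comm_coef i u : (size u < k.-1)%N ->
    magnus w (i :: u) = (i == q)%:R * magnus w (rcons u q).
  move=> Hu; have Hs : (size (rcons (i :: u) q) < k.+1)%N by rewrite size_rcons /=; lia.
  have := comm _ Hs; rewrite ncB magnus_mul_gen_rcons [X in _ - X]magnus_mul_gen_cons.
  by rewrite /= opprD addrACA subrr add0r => /eqP; rewrite subr_eq0 => /eqP.
case: k comm comm_coef => [|k] // comm comm_coef.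
apply: magnus_ord_gamma => u Hu; rewrite ncB nc1E.
case: u Hu => [|i u] Hu; first by rewrite magnus_nil subrr.
rewrite subr0.
have [m [Em|[a [v [Em neq]]]]] : exists m, i :: u = nseq m q \/
    exists a v, i :: u = nseq m q ++ a :: v /\ a != q.
  elim: (i :: u) => [|b s [m IH]]; first by exists 0%N; left.
  have [->|neq] := eqVneq b q; last by exists 0%N; right; exists b, s.
  exists m.+1; case: IH => [->|[a [v [-> neq]]]]; first by left.
  by right; exists a, v.
  by case: m Em => [|m] // ->; apply: magnus_power0.
rewrite {}Em in Hu *; elim: m v Hu => [|m IH] v Hu.
  by rewrite comm_coef ?(negbTE neq) ?mul0r.
rewrite /= comm_coef; last by move: Hu; rewrite /=; lia.
rewrite eqxx mul1r rcons_cat rcons_cons; apply: IH.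
by move: Hu; rewrite /= !size_cat /= size_rcons; lia.
Qed.

End MagnusCoefficients.

(** * Comparison of the two filtrations *)

Lemma triangular_GammaAut n p k (f : End_ n) :
    (p <= n)%N -> triangular p f -> acts_trivially k.+2 f ->
  GammaAut n (PartialInner n) k.+2 f.
Proof.
elim: p f => [|[|p] IH] f lepn; try by move=> -> _; apply: gen_one.
rewrite triangularSS => -[w [h [sw Hh Ef]]] Hf.
(* [q] is the last generator moved by the outer factor and is fixed by [h]; [z] is the first
   generator, and its image under [h] does not involve [q]. *)
pose q : 'I_n := Ordinal lepn; pose z : 'I_n := Ordinal (leq_trans (ltn0Sn _) lepn).
have Efz : evalE n f (FGgen n z) = (w * evalE n h (FGgen n z) * w^-1)%g.
  rewrite Ef evalE_comp conj_aut_supp //.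
  by apply: triangular_supp Hh _ _; [exact: leqnSn | exact: supp_gen].
have Efq : evalE n f (FGgen n q) = (w * FGgen n q * w^-1)%g.
  rewrite Ef evalE_comp evalE_gen (triangular_fix Hh) // conj_aut_supp //.
  exact: supp_gen.
have comm x y : evalE n f x = (w * y * w^-1)%g -> mcongr k.+3 (x * w)%g (w * y)%g.
  move=> E; have := mcongrM (Hf x) (mcongr_refl w); rewrite E.
  by rewrite mulgVK.
have sz : supp p.+1 (evalE n h (FGgen n z)).
  by apply: triangular_supp Hh _ _ => //; apply: supp_gen.
(* Compare the coefficients of [[:: z; q]]. Multiplying [w] by [x_z] on the left adds the
   coefficient at [[:: q]], while the factor [h x_z] on the right adds nothing, [q] being absent
   from it. This degree 2 word is visible because the index is at least 2. *)
have w0 : magnus w [:: q] = 0.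
  have /eqP := comm _ _ Efz [:: z; q] isT.
  rewrite ncB magnus_mul_gen_cons eqxx mul1r magnusM !ncM_cons ncM_nil.
  rewrite /nc_shift magnus_nil mul1r.
  rewrite !(magnus_supp (a := q) (u := _ :: _) sz) ?inE ?eqxx ?orbT //.
  rewrite magnus_nil mulr0 mulr1 !add0r opprD addrA subrr sub0r oppr_eq0.
  by move/eqP.
have gw : gamma k.+2 w by apply: (@gamma_centralizer _ q) => //; apply: comm.
have lep : (2 <= p.+2 <= n)%N by [].
have GC : GammaAut n (PartialInner n) k.+2 (conj_aut p.+2 w).
  by rewrite -[w]sw; apply: conj_aut_gamma.
(* By the inclusion already proved, the outer factor acts trivially to the same depth; hence so does
   [h], to which the induction applies. *)
have [_ Ac] := GammaAut_acts GC.
have Eh : h = compE n (conj_aut p.+2 w^-1%g) f.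
  by rewrite Ef compEA conj_aut_comp // mulVg conj_aut1 comp1E.
rewrite Ef; apply: gen_mul => //; apply: IH => //; first exact: ltnW.
rewrite Eh; apply: acts_comp => //; exact: acts_inv (conj_aut_inv sw) Ac.
Qed.

Theorem theorem3p3p7 (n : nat) (hn : (2 <= n)%N) (k : nat) (hk : (1 <= k)%N) :
  forall phi : End_ n,
    (Andreadakis n k phi /\ PartialInner n phi) <->
    GammaAut n (PartialInner n) k phi.
Proof.
case: k hk => [|k] // _ phi; split=> [[/Andreadakis_acts[_ Hphi] Pphi]|Gphi].
  (* At index 1 the term of the lower central series is [PartialInner n] itself. *)
  case: k Hphi => [|k] // Hphi; apply: triangular_GammaAut (leqnn n) _ Hphi.
  exact: PartialInner_triangular.
have [Pphi Aphi] := GammaAut_acts Gphi; split=> //; apply/Andreadakis_acts; split=> //.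
by have [phi' inv_phi _] := PartialInner_inv Pphi; apply: isinvE_isAut inv_phi.
Qed.
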